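(* Let $V_3=\{0,1\}^3$ be the vertex set of the 3-cube $Cu_3$, ordered lexicographically, let $d(\varepsilon,\delta)=\sum_{i=1}^3|\varepsilon_i-\delta_i|$, and for distinct $\varepsilon,\delta\in V_3$ put $\lfloor\varepsilon\delta\rfloor=\max\{\varepsilon,\delta\}\min\{\varepsilon,\delta\}$ (Lie product). A Gröbner–Shirshov basis $S$ for the partial commutative metabelian Lie algebra related to the 3-cube $$\mathcal{ML}_{Cu_3}=\mathcal{L}_{(2)}(V_3\ |\ \varepsilon\delta,\ d(\varepsilon,\delta)=1,\ \varepsilon>\delta)$$ is the union of the following sets (all letters range over $V_3$, all products are left-normed): $$R_2=\{\lfloor\varepsilon\delta\rfloor\mid d(\varepsilon,\delta)=1\},$$ $$R_3=\{\lfloor\varepsilon\delta\rfloor\mu\mid d(\varepsilon,\delta)=2,\ \lfloor\mu\varepsilon\rfloor,\lfloor\mu\delta\rfloor\in R_2\},$$ $$R_4=\{\lfloor\varepsilon\delta\rfloor\mu\gamma\mid d(\varepsilon,\delta)=3,\ \lfloor\mu\varepsilon\rfloor\in R_2,\ \lfloor\mu\delta\rfloor\gamma\in R_3\},$$ $$R_5=\{\lfloor\delta_1\delta_2\rfloor\gamma\langle\mu_1\mu_2\rangle\mid d(\delta_1,\delta_2)=2,\ \lfloor\gamma\delta_i\rfloor\mu_i\in R_3,\ i=1,2\},$$ $$R_5'=\{\lfloor\delta_1\delta_2\rfloor\gamma\mu\mu'\mid d(\delta_1,\delta_2)=2,\ \lfloor\gamma\delta_1\rfloor\in R_2,\ \lfloor\gamma\delta_2\rfloor\mu\mu'\in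 R_4,\ d(\mu,\delta_1)\ne1\}.$$
   Context: $\mathbf{k}$ is a field of arbitrary characteristic. The $3$-cube $Cu_3$ is the graph on $V_3$ in which two vertices are adjacent iff they differ in exactly one coordinate. $\mathcal{L}_{(2)}(X)=Lie(X)/Lie(X)^{(2)}$ is the free metabelian Lie algebra over $\mathbf{k}$ on the well-ordered set $X$, where $Lie(X)$ is the free Lie algebra on $X$ and $\mathcal{L}^{(0)}=\mathcal{L}$, $\mathcal{L}^{(n+1)}=[\mathcal{L}^{(n)},\mathcal{L}^{(n)}]$; $\mathcal{L}_{(2)}(X|S)=\mathcal{L}_{(2)}(X)/Id(S)$, where $Id(S)$ is the ideal generated by $S$. The Lie product is written $uv$ or $u\cdot v$; products without brackets are left-normed. ''A Gröbner–Shirshov basis for $\mathcal{L}_{(2)}(X|S)$'' is a Gröbner–Shirshov basis in $\mathcal{L}_{(2)}(X)$ generating $Id(S)$. Words. $[X]$ is the free commutative monoid on $X$; $\langle a_{1}\cdots a_{m}\rangle$ denotes the letters rearranged in non-decreasing order. $R=\{a_0a_1\cdots a_n \mid n\ge1,\ a_i\in X,\ a_0>a_1\le a_2\le\cdots\le a_n\}$ and $N=X\cup R$ (regular words), a $\mathbf{k}$-basis of $\mathcal{L}_{(2)}(X)$. Each $f$ is uniquely $f=f^{(1)}+f^{(0)}$, $f^{(1)}\in\mathbf{k}R$, $f^{(0)}\in\mathbf{k}X$. Length: $|a|=1$ for $a\in X$, $|a_0a_1\cdots a_n|=n+1$. $N$ is ordered degree-lexicographically (first by length, then lexicographically). For $f\ne0$,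 $\bar f$ is the largest word occurring in $f$ with nonzero coefficient (leading word); $f$ is monic if the coefficient of $\bar f$ is $1$. Conditions mentioning $\bar h$ presuppose $h\ne0$. Normal $S$-words: (i) $sa_1a_2\cdots a_n$ with $s\in S$, $n\ge0$, $a_i\in X$, $a_1\le\cdots\le a_n$, $\bar s\ne a_1$ (no condition on letters if $n=0$); (ii) $us$ with $u\in R$, $s\in S$, $\bar s\neq u$. Compositions. Let $f,g$ be monic, $\alpha,\beta$ the coefficients of $\overline{f^{(0)}}$, $\overline{g^{(0)}}$ in $f$, $g$. $f\langle c_1\cdots c_r\rangle$ is the left-normed product of $f$ by the letters in non-decreasing order; a hat means omission. Type I: $\bar f=a_0a_1\cdots a_n$, $\bar g=a_0b_1\cdots b_m$ ($n,m\ge0$), and $L\neq\langle a_1\cdots a_nb_1\cdots b_m\rangle$, where $L$ is the least common multiple in $[X]$ of $a_1\cdots a_n$ and $b_1\cdots b_m$; $w=a_0\langle L\rangle$: $C_I(f,g)_w=f\langle L/(a_1\cdots a_n)\rangle-g\langle L/(b_1\cdots b_m)\rangle$. Type II: $\bar f=\overline{f^{(1)}}=a_0a_1\cdots a_n$, and $\overline{g^{(0)}}=a_i$ for some $i\ge2$, or $\overline{g^{(0)}}=a_1$ (put $i=1$) and $a_0>a_2$; $w=\bar f$: $C_{II}(f,g)_w=f-\beta^{-1}a_0a_1\cdots\hat{a_i}\cdots a_n\cdot g$. Type III: $\bar f=\overline{f^{(1)}}=a_0a_1\cdots a_n$, $\bar g=\overline{g^{(0)}}=a_1$, and $a_0\le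 a_2$ or $n=1$; $w=\bar f$: $C_{III}(f,g)_w=f+ga_0a_2\cdots a_n$. Type IV: $\bar f=\overline{f^{(1)}}=a_0a_1\cdots a_n$, $g^{(1)}\ne0$, $\overline{g^{(0)}}=a_1$, and $a_0\le a_2$ or $n=1$; for any $a\in X$ with $a<a_0$, $w=a_0\langle a_1\cdots a_na\rangle$: $C_{IV}(f,g)_w=fa-\beta^{-1}a_0aa_2\cdots a_n\cdot g$. Type V: $\bar f=\overline{f^{(1)}}=a_0a_1\cdots a_n$, $f^{(0)}\ne0$, $g^{(1)}\ne0$, $\overline{g^{(0)}}=b\notin\{a_i\}_{i=1}^n$; $w=a_0\langle a_1\cdots a_nb\rangle$: $C_V(f,g)_w=fb-\beta^{-1}a_0a_1\cdots a_n\cdot g$. Type VI: $\overline{f^{(0)}}=\overline{g^{(0)}}=a$, $f^{(1)}\ne0$; for any $a_0a_1\in R$, $w=a_0\langle a_1a\rangle$: $C_{VI}(f,g)_w=(a_0a_1)(\alpha^{-1}f-\beta^{-1}g)$. Type VII: $f^{(1)}\ne0$, $g^{(1)}\ne0$, $\overline{f^{(0)}}=a>\overline{g^{(0)}}=b$; for any $a_0\in X$, $a_0>a$, $w=a_0ba$: $C_{VII}(f,g)_w=\alpha^{-1}(a_0b)f-\beta^{-1}(a_0a)g$. Triviality: for a set $S$ of monic polynomials and $w\in N$, $f\equiv0\ mod(S,w)$ means that $f$ is a $\mathbf{k}$-linear combination of normal $S$-words $u_s$ with $\overline{u_s}<w$. $S$ is a Gröbner–Shirshov basis if $C_\lambda(f,g)_w\equiv0\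 mod(S,w)$ for all $f,g\in S$ and all compositions of types I–VII. *)

(* Defs.v *)
From HB Require Import structures.
From mathcomp Require Import all_boot all_order all_algebra.
From mathcomp Require Import finmap multiset.
From mathcomp Require Import boolp classical_sets.

Set Implicit Arguments.
Unset Strict Implicit.
Unset Printing Implicit Defensive.

Import Order.TTheory GRing.Theory.

Local Open Scope quotient_scope.
Local Open Scope classical_set_scope.
Local Open Scope ring_scope.

Reserved Notation "x ** y" (at level 40, left associativity).

HB.mixin Record Lmodule_isLieAlg (k : fieldType) L of GRing.Lmodule k L := {
  lbr : L -> L -> L;
  lbr_linearl : forall (c : k) x y z, lbr (c *: x + y) z = c *: lbr x z + lbr y z;
  lbr_linearr : forall (c : k) x y z, lbr z (c *: x + y) = c *: lbr z x + lbr z y;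
  lbrxx : forall x, lbr x x = 0;
  lbr_jacobi : forall x y z,
    lbr (lbr x y) z + lbr (lbr y z) x + lbr (lbr z x) y = 0
}.

#[short(type="lieAlgType")]
HB.structure Definition LieAlg (k : fieldType) :=
  {L of Lmodule_isLieAlg k L & GRing.Lmodule k L}.

Notation "x ** y" := (lbr x y) : ring_scope.

Section LieTheory.
Variables (k : fieldType) (L : lieAlgType k).
Implicit Types (A B : set L) (x y z : L).

Definition span A : set L :=
  [set x | exists (n : nat) (c : 'I_n -> k) (v : 'I_n -> L),
     (forall i, A (v i)) /\ x = \sum_(i < n) c i *: v i].

(* One-sided absorption suffices: the bracket is anticommutative *)
Definition is_ideal (I : set L) : Prop :=
  [/\ I 0,
      forall (c : k) x y, I x -> I y -> I (c *: x + y) &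
      forall x y, I x -> I (x ** y)].

Record lieIdeal := LieIdeal { ideal_set :> L -> Prop; idealP : is_ideal ideal_set }.

Definition ideal_gen A : set L :=
  [set x | forall I, is_ideal I -> A `<=` I -> I x].

Definition lieprod A B : set L := span [set x ** y | x in A & y in B].

Fixpoint derived (n : nat) : set L :=
  if n is m.+1 then lieprod (derived m) (derived m) else setT.

Lemma lbrDl x y z : (x + y) ** z = x ** z + y ** z.
Proof. by rewrite -[x in x + y]scale1r lbr_linearl scale1r. Qed.

Lemma lbrDr x y z : z ** (x + y) = z ** x + z ** y.
Proof. by rewrite -[x in x + y]scale1r lbr_linearr scale1r. Qed.

Lemma lbr0l z : 0 ** z = 0.
Proof. by apply: (@addrI _ (0 ** z)); rewrite -lbrDl !addr0. Qed.

Lemma lbr0r z : z ** 0 = 0.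
Proof. by apply: (@addrI _ (z ** 0)); rewrite -lbrDr !addr0. Qed.

Lemma lbrZl (c : k) x z : (c *: x) ** z = c *: (x ** z).
Proof. by rewrite -[c *: x]addr0 lbr_linearl lbr0l addr0. Qed.

Lemma lbrZr (c : k) x z : z ** (c *: x) = c *: (z ** x).
Proof. by rewrite -[c *: x]addr0 lbr_linearr lbr0r addr0. Qed.

Lemma lbrC x y : x ** y = - (y ** x).
Proof.
apply/eqP; rewrite -addr_eq0; apply/eqP.
by have := lbrxx (x + y); rewrite lbrDl !lbrDr !lbrxx addr0 add0r.
Qed.

Lemma lbrNl x z : (- x) ** z = - (x ** z).
Proof. by rewrite -scaleN1r lbrZl scaleN1r. Qed.

Lemma lbrNr x z : z ** (- x) = - (z ** x).
Proof. by rewrite -scaleN1r lbrZr scaleN1r. Qed.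

Lemma lbr_leibniz x y z : (x ** y) ** z = x ** (y ** z) + (x ** z) ** y.
Proof.
have /eqP := lbr_jacobi x y z; rewrite -addrA addr_eq0 => /eqP ->.
by rewrite opprD -lbrC -lbrNl -lbrC.
Qed.

Lemma ideal0 (I : lieIdeal) : I 0.
Proof. by case: (idealP I). Qed.

Lemma idealPZ (I : lieIdeal) (c : k) x y : I x -> I y -> I (c *: x + y).
Proof. by case: (idealP I) => _ h _; apply: h. Qed.

Lemma idealD (I : lieIdeal) x y : I x -> I y -> I (x + y).
Proof. by move=> Ix /(idealPZ 1 Ix); rewrite scale1r. Qed.

Lemma idealZ (I : lieIdeal) (c : k) x : I x -> I (c *: x).
Proof. by move=> /(idealPZ c) /(_ (ideal0 I)); rewrite addr0. Qed.

Lemma idealN (I : lieIdeal) x : I x -> I (- x).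
Proof. by rewrite -scaleN1r; apply: idealZ. Qed.

Lemma idealMl (I : lieIdeal) x y : I x -> I (x ** y).
Proof. by case: (idealP I) => _ _; apply. Qed.

Lemma idealMr (I : lieIdeal) x y : I x -> I (y ** x).
Proof. by move=> Ix; rewrite lbrC; apply: idealN; apply: idealMl. Qed.

Lemma span0 A : span A 0.
Proof.
exists 0%N, (fun=> 0), (fun=> 0); split; first by case.
by rewrite big_ord0.
Qed.

Lemma span_sub A : A `<=` span A.
Proof.
move=> x Ax; exists 1%N, (fun=> 1), (fun=> x); split=> //.
by rewrite big_ord1 scale1r.
Qed.

Lemma spanPZ A (c : k) x y : span A x -> span A y -> span A (c *: x + y).
Proof.
move=> [n [a [u [Au ->]]]] [m [b [v [Av ->]]]].
exists (n + m)%N,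
  (fun i => match split i with inl j => c * a j | inr j => b j end),
  (fun i => match split i with inl j => u j | inr j => v j end).
split; first by move=> i; case: (split i).
rewrite big_split_ord scaler_sumr; congr (_ + _); apply: eq_bigr => i _.
  by rewrite (unsplitK (inl i)) scalerA.
by rewrite (unsplitK (inr i)).
Qed.

Lemma lieprod_ideal (I J : lieIdeal) : is_ideal (lieprod I J).
Proof.
split=> [|c x y|x y]; [exact: span0 | exact: spanPZ |].
move=> [n [c [v [vP ->]]]].
have addlr (F : 'I_n -> L) : (\sum_i F i) ** y = \sum_i F i ** y.
  apply: (big_morph (fun u => u ** y)); last exact: lbr0l.
  by move=> *; rewrite lbrDl.
rewrite addlr; elim/big_ind: _ => [|a b Pa Pb|i _]; first exact: span0.
  by rewrite -[a]scale1r; apply: spanPZ.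
rewrite lbrZl -[_ *: _]addr0; apply: spanPZ (span0 _).
have [a Ia [b Jb <-]] := vP i; rewrite lbr_leibniz -[X in X + _]scale1r.
apply: spanPZ; apply: span_sub.
  by exists a => //; exists (b ** y) => //; apply: idealMl.
by exists (a ** y); [apply: idealMl | exists b].
Qed.

Lemma setT_ideal : is_ideal [set: L].
Proof. by []. Qed.

Lemma derived_ideal n : is_ideal (derived n).
Proof.
elim: n => [|n IHn]; first exact: setT_ideal.
exact: (@lieprod_ideal (LieIdeal IHn) (LieIdeal IHn)).
Qed.

Definition derivedI (n : nat) : lieIdeal := LieIdeal (derived_ideal n).

End LieTheory.

Section QuotientByIdeal.
Variables (k : fieldType) (L : lieAlgType k) (I : lieIdeal L).

Definition ideal_eqv : rel L := fun x y => `[< I (x - y) >].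

Lemma ideal_eqv_equiv : equiv_class_of ideal_eqv.
Proof.
split=> [x|x y|y x z].
- by apply/asboolP; rewrite subrr; apply: ideal0.
- by apply/asboolP/asboolP => /idealN; rewrite opprB.
- move=> /asboolP h1 /asboolP h2; apply/asboolP.
  by have := idealD h1 h2; rewrite addrA subrK.
Qed.

Canonical ideal_equiv := EquivRelPack ideal_eqv_equiv.

Definition lie_quot := {eq_quot ideal_equiv}.

HB.instance Definition _ := Choice.on lie_quot.
HB.instance Definition _ := EqQuotient.on lie_quot.

Lemma lie_quotP (x y : L) :
  reflect (\pi_lie_quot x = \pi_lie_quot y) `[< I (x - y) >].
Proof. exact: (@eqquotP _ _ lie_quot). Qed.

Lemma repr_lie_quot (x : L) : I (repr (\pi_lie_quot x) - x).
Proof. by apply/asboolP/lie_quotP; rewrite reprK. Qed.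

Definition lq_zero : lie_quot := \pi_lie_quot 0.
Definition lq_add (x y : lie_quot) : lie_quot := locked (\pi_lie_quot (repr x + repr y)).
Definition lq_opp (x : lie_quot) : lie_quot := locked (\pi_lie_quot (- repr x)).
Definition lq_scale (c : k) (x : lie_quot) : lie_quot := locked (\pi_lie_quot (c *: repr x)).
Definition lq_br (x y : lie_quot) : lie_quot := locked (\pi_lie_quot (repr x ** repr y)).

Lemma lq_addE x y : lq_add (\pi_lie_quot x) (\pi_lie_quot y) = \pi_lie_quot (x + y).
Proof.
rewrite /lq_add -lock; apply/lie_quotP/asboolP; rewrite opprD addrACA.
by apply: idealD; apply: repr_lie_quot.
Qed.

Lemma lq_oppE x : lq_opp (\pi_lie_quot x) = \pi_lie_quot (- x).
Proof.
by rewrite /lq_opp -lock; apply/lie_quotP/asboolP; rewrite -opprD; apply/idealN/repr_lie_quot.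
Qed.

Lemma lq_scaleE c x : lq_scale c (\pi_lie_quot x) = \pi_lie_quot (c *: x).
Proof.
by rewrite /lq_scale -lock; apply/lie_quotP/asboolP; rewrite -scalerBr; apply/idealZ/repr_lie_quot.
Qed.

Lemma lq_brE x y : lq_br (\pi_lie_quot x) (\pi_lie_quot y) = \pi_lie_quot (x ** y).
Proof.
rewrite /lq_br -lock; apply/lie_quotP/asboolP; set x' := repr _; set y' := repr _.
have -> : x' ** y' - x ** y = x' ** (y' - y) + (x' - x) ** y.
  by rewrite lbrDr lbrDl lbrNr lbrNl addrA subrK.
by apply: idealD; [apply: idealMr | apply: idealMl]; apply: repr_lie_quot.
Qed.

Lemma lq_addA : associative lq_add.
Proof. by move=> x y z; elim/quotW: x => x; elim/quotW: y => y; elim/quotW: z => z; rewrite !lq_addE addrA. Qed.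
Lemma lq_addC : commutative lq_add.
Proof. by move=> x y; elim/quotW: x => x; elim/quotW: y => y; rewrite !lq_addE addrC. Qed.
Lemma lq_add0 : left_id lq_zero lq_add.
Proof. by move=> x; elim/quotW: x => x; rewrite lq_addE add0r. Qed.
Lemma lq_addN : left_inverse lq_zero lq_opp lq_add.
Proof. by move=> x; elim/quotW: x => x; rewrite lq_oppE lq_addE addNr. Qed.

HB.instance Definition _ :=
  GRing.isZmodule.Build lie_quot lq_addA lq_addC lq_add0 lq_addN.

Lemma piD x y : \pi_lie_quot (x + y) = \pi_lie_quot x + \pi_lie_quot y.
Proof. by rewrite -lq_addE. Qed.

Lemma lq_scaleA a b x : lq_scale a (lq_scale b x) = lq_scale (a * b) x.
Proof. by elim/quotW: x => x; rewrite !lq_scaleE scalerA. Qed.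
Lemma lq_scale1 : left_id 1 lq_scale.
Proof. by move=> x; elim/quotW: x => x; rewrite lq_scaleE scale1r. Qed.
Lemma lq_scaleDr : right_distributive lq_scale +%R.
Proof. by move=> c; move=> x y; elim/quotW: x => x; elim/quotW: y => y; rewrite !lq_scaleE -!piD lq_scaleE scalerDr. Qed.
Lemma lq_scaleDl x : {morph lq_scale^~ x : a b / a + b}.
Proof. by elim/quotW: x => x a b; rewrite !lq_scaleE -piD scalerDl. Qed.

HB.instance Definition _ := GRing.Zmodule_isLmodule.Build k lie_quot
  lq_scaleA lq_scale1 lq_scaleDr lq_scaleDl.

Lemma piZ c x : \pi_lie_quot (c *: x) = c *: \pi_lie_quot x.
Proof. by rewrite -lq_scaleE. Qed.

Lemma lq_brl c x y z : lq_br (c *: x + y) z = c *: lq_br x z + lq_br y z.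
Proof.
elim/quotW: x => x; elim/quotW: y => y; elim/quotW: z => z.
by rewrite -piZ -piD !lq_brE lbr_linearl piD piZ.
Qed.
Lemma lq_brr c x y z : lq_br z (c *: x + y) = c *: lq_br z x + lq_br z y.
Proof.
elim/quotW: x => x; elim/quotW: y => y; elim/quotW: z => z.
by rewrite -piZ -piD !lq_brE lbr_linearr piD piZ.
Qed.
Lemma lq_brxx x : lq_br x x = 0.
Proof. by elim/quotW: x => x; rewrite lq_brE lbrxx. Qed.
Lemma lq_jacobi x y z :
  lq_br (lq_br x y) z + lq_br (lq_br y z) x + lq_br (lq_br z x) y = 0.
Proof.
elim/quotW: x => x; elim/quotW: y => y; elim/quotW: z => z.
by rewrite !lq_brE -!piD lbr_jacobi.
Qed.

HB.instance Definition _ := Lmodule_isLieAlg.Build k lie_quot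
  lq_brl lq_brr lq_brxx lq_jacobi.

End QuotientByIdeal.

(* Lie(X): formal terms modulo the smallest congruence containing the axioms *)
(* of Lie algebras over k                                                    *)
Section FreeLie.
Variables (k : fieldType) (X : Type).

Inductive lterm : Type :=
| TVar of X
| TZero
| TAdd of lterm & lterm
| TOpp of lterm
| TScale of k & lterm
| TBr of lterm & lterm.

Inductive lcong : lterm -> lterm -> Prop :=
| LC_refl x : lcong x x
| LC_sym x y : lcong x y -> lcong y x
| LC_trans y x z : lcong x y -> lcong y z -> lcong x z
| LC_add x x' y y' : lcong x x' -> lcong y y' -> lcong (TAdd x y) (TAdd x' y')
| LC_opp x x' : lcong x x' -> lcong (TOpp x) (TOpp x')
| LC_scale c x x' : lcong x x' -> lcong (TScale c x) (TScale c x')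
| LC_br x x' y y' : lcong x x' -> lcong y y' -> lcong (TBr x y) (TBr x' y')
| LC_addA x y z : lcong (TAdd x (TAdd y z)) (TAdd (TAdd x y) z)
| LC_addC x y : lcong (TAdd x y) (TAdd y x)
| LC_add0 x : lcong (TAdd TZero x) x
| LC_addN x : lcong (TAdd (TOpp x) x) TZero
| LC_scaleA a b x : lcong (TScale a (TScale b x)) (TScale (a * b) x)
| LC_scale1 x : lcong (TScale 1 x) x
| LC_scaleDr a x y : lcong (TScale a (TAdd x y)) (TAdd (TScale a x) (TScale a y))
| LC_scaleDl a b x : lcong (TScale (a + b) x) (TAdd (TScale a x) (TScale b x))
| LC_brl c x y z :
    lcong (TBr (TAdd (TScale c x) y) z) (TAdd (TScale c (TBr x z)) (TBr y z))
| LC_brr c x y z :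
    lcong (TBr z (TAdd (TScale c x) y)) (TAdd (TScale c (TBr z x)) (TBr z y))
| LC_brxx x : lcong (TBr x x) TZero
| LC_jacobi x y z :
    lcong (TAdd (TAdd (TBr (TBr x y) z) (TBr (TBr y z) x)) (TBr (TBr z x) y)) TZero.

HB.instance Definition _ := gen_eqMixin lterm.
HB.instance Definition _ := gen_choiceMixin lterm.

Definition lterm_eqv : rel lterm := fun x y => `[< lcong x y >].

Lemma lterm_eqv_equiv : equiv_class_of lterm_eqv.
Proof.
split=> [x|x y|y x z].
- exact/asboolP/LC_refl.
- by apply/asboolP/asboolP => /LC_sym.
- by move=> /asboolP h1 /asboolP h2; apply/asboolP; apply: LC_trans h1 h2.
Qed.

Canonical lterm_equiv := EquivRelPack lterm_eqv_equiv.

Definition free_lie := {eq_quot lterm_equiv}.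

HB.instance Definition _ := Choice.on free_lie.
HB.instance Definition _ := EqQuotient.on free_lie.

Lemma free_lieP (x y : lterm) : \pi_free_lie x = \pi_free_lie y <-> lcong x y.
Proof.
split=> [/(@eqquotP _ _ free_lie)/asboolP //|h].
exact/(@eqquotP _ _ free_lie)/asboolP.
Qed.

Lemma repr_free_lie (x : lterm) : lcong (repr (\pi_free_lie x)) x.
Proof. by apply/free_lieP; rewrite reprK. Qed.

Definition fl_zero : free_lie := \pi_free_lie TZero.
Definition fl_add (x y : free_lie) : free_lie := locked (\pi_free_lie (TAdd (repr x) (repr y))).
Definition fl_opp (x : free_lie) : free_lie := locked (\pi_free_lie (TOpp (repr x))).
Definition fl_scale (c : k) (x : free_lie) : free_lie := locked (\pi_free_lie (TScale c (repr x))).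
Definition fl_br (x y : free_lie) : free_lie := locked (\pi_free_lie (TBr (repr x) (repr y))).

Lemma fl_addE x y : fl_add (\pi_free_lie x) (\pi_free_lie y) = \pi_free_lie (TAdd x y).
Proof. by rewrite /fl_add -lock; apply/free_lieP/LC_add; apply: repr_free_lie. Qed.
Lemma fl_oppE x : fl_opp (\pi_free_lie x) = \pi_free_lie (TOpp x).
Proof. by rewrite /fl_opp -lock; apply/free_lieP/LC_opp; apply: repr_free_lie. Qed.
Lemma fl_scaleE c x : fl_scale c (\pi_free_lie x) = \pi_free_lie (TScale c x).
Proof. by rewrite /fl_scale -lock; apply/free_lieP/LC_scale; apply: repr_free_lie. Qed.
Lemma fl_brE x y : fl_br (\pi_free_lie x) (\pi_free_lie y) = \pi_free_lie (TBr x y).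
Proof. by rewrite /fl_br -lock; apply/free_lieP/LC_br; apply: repr_free_lie. Qed.

Lemma fl_addA : associative fl_add.
Proof.
move=> x y z; elim/quotW: x => x; elim/quotW: y => y; elim/quotW: z => z; rewrite !fl_addE.
exact/free_lieP/LC_addA.
Qed.
Lemma fl_addC : commutative fl_add.
Proof. by move=> x y; elim/quotW: x => x; elim/quotW: y => y; rewrite !fl_addE; apply/free_lieP/LC_addC. Qed.
Lemma fl_add0 : left_id fl_zero fl_add.
Proof. by move=> x; elim/quotW: x => x; rewrite fl_addE; apply/free_lieP/LC_add0. Qed.
Lemma fl_addN : left_inverse fl_zero fl_opp fl_add.
Proof. by move=> x; elim/quotW: x => x; rewrite fl_oppE fl_addE; apply/free_lieP/LC_addN. Qed.

HB.instance Definition _ :=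
  GRing.isZmodule.Build free_lie fl_addA fl_addC fl_add0 fl_addN.

Lemma fl_scaleA a b x : fl_scale a (fl_scale b x) = fl_scale (a * b) x.
Proof. by elim/quotW: x => x; rewrite !fl_scaleE; apply/free_lieP/LC_scaleA. Qed.
Lemma fl_scale1 : left_id 1 fl_scale.
Proof. by move=> x; elim/quotW: x => x; rewrite fl_scaleE; apply/free_lieP/LC_scale1. Qed.
Lemma fl_scaleDr : right_distributive fl_scale +%R.
Proof.
move=> c; move=> x y; elim/quotW: x => x; elim/quotW: y => y.
rewrite -[_ + _]/(fl_add _ _) -[RHS]/(fl_add _ _) !(fl_addE, fl_scaleE).
exact/free_lieP/LC_scaleDr.
Qed.
Lemma fl_scaleDl x : {morph fl_scale^~ x : a b / a + b}.
Proof.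
elim/quotW: x => x a b; rewrite -[RHS]/(fl_add _ _) !(fl_addE, fl_scaleE).
exact/free_lieP/LC_scaleDl.
Qed.

HB.instance Definition _ := GRing.Zmodule_isLmodule.Build k free_lie
  fl_scaleA fl_scale1 fl_scaleDr fl_scaleDl.

Lemma fl_brl c x y z : fl_br (c *: x + y) z = c *: fl_br x z + fl_br y z.
Proof.
elim/quotW: x => x; elim/quotW: y => y; elim/quotW: z => z.
rewrite -[LHS]/(fl_br (fl_add (fl_scale _ _) _) _).
rewrite -[RHS]/(fl_add (fl_scale _ _) _).
by rewrite !(fl_addE, fl_scaleE, fl_brE); apply/free_lieP/LC_brl.
Qed.
Lemma fl_brr c x y z : fl_br z (c *: x + y) = c *: fl_br z x + fl_br z y.
Proof.
elim/quotW: x => x; elim/quotW: y => y; elim/quotW: z => z.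
rewrite -[LHS]/(fl_br _ (fl_add (fl_scale _ _) _)).
rewrite -[RHS]/(fl_add (fl_scale _ _) _).
by rewrite !(fl_addE, fl_scaleE, fl_brE); apply/free_lieP/LC_brr.
Qed.
Lemma fl_brxx x : fl_br x x = 0.
Proof. by elim/quotW: x => x; rewrite fl_brE; apply/free_lieP/LC_brxx. Qed.
Lemma fl_jacobi x y z :
  fl_br (fl_br x y) z + fl_br (fl_br y z) x + fl_br (fl_br z x) y = 0.
Proof.
elim/quotW: x => x; elim/quotW: y => y; elim/quotW: z => z.
rewrite -[LHS]/(fl_add (fl_add _ _) _) !(fl_addE, fl_brE).
exact/free_lieP/LC_jacobi.
Qed.

HB.instance Definition _ := Lmodule_isLieAlg.Build k free_lie
  fl_brl fl_brr fl_brxx fl_jacobi.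

Definition free_metab := lie_quot (derivedI free_lie 2).

HB.instance Definition _ := LieAlg.on free_metab.

Definition gen (x : X) : free_metab := \pi_free_metab (\pi_free_lie (TVar x)).

End FreeLie.

Section Words.
Context {disp : Order.disp_t} {X : orderType disp}.
Implicit Types (a b : X) (u v w : seq X).

(* A nonempty sequence a0 :: s stands for the left-normed word a0 a1 ... an *)
Definition in_X w : bool := size w == 1%N.

Definition in_R w : bool :=
  if w is a0 :: a1 :: s then (a1 < a0)%O && sorted <=%O (a1 :: s) else false.

Definition in_N w : bool := in_X w || in_R w.

Definition wlt u v : bool :=
  (size u < size v)%N ||
  ((size u == size v) && ((u : seqlexi X) < (v : seqlexi X))%O).

Definition wle u v : bool := (u == v) || wlt u v.

(* <c1 ... cr> *)
Definition angle u : seq X := sort <=%O u.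

(* The monomial a1 ... an of [X]; the free commutative monoid on X is {mset X} *)
Definition mon u : {mset X}%mset := seq_mset u.

(* lcm and quotient of monomials, listed in non-decreasing order *)
Definition mlcm u v : seq X := angle (mon u `|` mon v)%mset.
Definition mdiv u v : seq X := angle (mon u `\` mon v)%mset.

End Words.

Section GroebnerShirshov.
Context {k : fieldType} {disp : Order.disp_t} {X : orderType disp}.
Local Notation L := (free_metab k X).
Local Notation x_ := (@gen k X).
Implicit Types (f g h s : L) (S T : set L) (u v w : seq X).

Definition lnprod f u : L := foldl (fun h a => h ** x_ a) f u.

Definition word w : L := if w is a :: u then lnprod (x_ a) u else 0.

Definition expands f (c : {fsfun seq X -> k with 0}) : Prop :=
  (forall w, w \in finsupp c -> in_N w) /\
  f = \sum_(w <- finsupp c) c w *: word w.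

(* Coordinates on the basis N; since N is a basis, exactly one c expands f *)
Definition coefN f : {fsfun seq X -> k with 0} :=
  xget [fsfun] [set c | expands f c].

Definition part1 f : L := \sum_(w <- finsupp (coefN f) | in_R w) coefN f w *: word w.
Definition part0 f : L := \sum_(w <- finsupp (coefN f) | in_X w) coefN f w *: word w.

(* w is the leading word of f; in particular f <> 0 *)
Definition is_lead f w : Prop :=
  w \in finsupp (coefN f) /\ forall u, u \in finsupp (coefN f) -> wle u w.

Definition monic_elt f : Prop := exists2 w, is_lead f w & coefN f w = 1.

Inductive normal_word S : L -> Prop :=
| NormalLetters s u of S s & sorted <=%O u &
    (forall a1 u', u = a1 :: u' -> exists2 v, is_lead s v & v <> [:: a1]) :
    normal_word S (lnprod s u)
| NormalWord u s of in_R u & S s & (exists2 v, is_lead s v & v <> u) :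
    normal_word S (word u ** s).

(* h = 0 mod (S, w) *)
Definition trivial_mod S w h : Prop :=
  span [set us | normal_word S us /\ exists2 v, is_lead us v & wlt v w] h.

(* composition f g w h: h is a composition of f and g with respect to w.     *)
(* In CompII the omitted letter a_i is b, and i >= 2 iff u is nonempty.      *)
Inductive composition f g : seq X -> L -> Prop :=
| CompI a0 u v of
    is_lead f (a0 :: u) & is_lead g (a0 :: v) &
    mlcm u v <> angle (u ++ v) :
    composition f g (a0 :: mlcm u v)
      (lnprod f (mdiv (mlcm u v) u) - lnprod g (mdiv (mlcm u v) v))
| CompII a0 u b v of
    is_lead f (a0 :: u ++ b :: v) & is_lead (part1 f) (a0 :: u ++ b :: v) &
    is_lead (part0 g) [:: b] &
    (u <> [::] \/ exists a2 v', v = a2 :: v' /\ (a2 < a0)%O) :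
    composition f g (a0 :: u ++ b :: v)
      (f - (coefN g [:: b])^-1 *: (word (a0 :: u ++ v) ** g))
| CompIII a0 a1 u of
    is_lead f (a0 :: a1 :: u) & is_lead (part1 f) (a0 :: a1 :: u) &
    is_lead g [:: a1] & is_lead (part0 g) [:: a1] &
    (u = [::] \/ exists a2 u', u = a2 :: u' /\ (a0 <= a2)%O) :
    composition f g (a0 :: a1 :: u) (f + lnprod g (a0 :: u))
| CompIV a0 a1 u a of
    is_lead f (a0 :: a1 :: u) & is_lead (part1 f) (a0 :: a1 :: u) &
    part1 g <> 0 & is_lead (part0 g) [:: a1] &
    (u = [::] \/ exists a2 u', u = a2 :: u' /\ (a0 <= a2)%O) &
    (a < a0)%O :
    composition f g (a0 :: angle (a1 :: u ++ [:: a]))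
      (f ** x_ a - (coefN g [:: a1])^-1 *: (word (a0 :: a :: u) ** g))
| CompV a0 u b of
    is_lead f (a0 :: u) & is_lead (part1 f) (a0 :: u) &
    part0 f <> 0 & part1 g <> 0 & is_lead (part0 g) [:: b] & b \notin u :
    composition f g (a0 :: angle (u ++ [:: b]))
      (f ** x_ b - (coefN g [:: b])^-1 *: (word (a0 :: u) ** g))
| CompVI a a0 a1 of
    is_lead (part0 f) [:: a] & is_lead (part0 g) [:: a] &
    part1 f <> 0 & in_R [:: a0; a1] :
    composition f g (a0 :: angle [:: a1; a])
      (word [:: a0; a1] **
         ((coefN f [:: a])^-1 *: f - (coefN g [:: a])^-1 *: g))
| CompVII a b a0 of
    part1 f <> 0 & part1 g <> 0 &
    is_lead (part0 f) [:: a] & is_lead (part0 g) [:: b] &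
    (b < a)%O & (a < a0)%O :
    composition f g [:: a0; b; a]
      ((coefN f [:: a])^-1 *: (word [:: a0; b] ** f) -
       (coefN g [:: b])^-1 *: (word [:: a0; a] ** g)).

Definition GS_basis S : Prop :=
  (forall f, S f -> monic_elt f) /\
  (forall f g w h, S f -> S g -> composition f g w h -> trivial_mod S w h).

(* S is a Groebner-Shirshov basis for the algebra presented by T *)
Definition GS_basis_for T S : Prop := GS_basis S /\ ideal_gen S = ideal_gen T.

End GroebnerShirshov.

Definition V3 := 3.-tuplelexi bool.

Definition dist (e d : V3) : nat := (\sum_(i < 3) `|(tnth e i : int) - (tnth d i : int)|)%N.

Section Cube.
Variable k : fieldType.
Local Notation L := (free_metab k V3).
Local Notation x_ := (@gen k V3).
Implicit Types (e d m c : V3) (h : L).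

(* Equal to 0 when e = d; hence lfloor e d in R2 forces e != d *)
Definition lfloor e d : L := x_ (Order.max e d) ** x_ (Order.min e d).

Definition cube_relations : set L :=
  [set h | exists e d, [/\ dist e d = 1%N, (d < e)%O & h = x_ e ** x_ d]].

Definition R2 : set L :=
  [set h | exists e d, dist e d = 1%N /\ h = lfloor e d].

Definition R3 : set L :=
  [set h | exists e d m, [/\ dist e d = 2%N, R2 (lfloor m e), R2 (lfloor m d) &
     h = lfloor e d ** x_ m]].

Definition R4 : set L :=
  [set h | exists e d m c, [/\ dist e d = 3%N, R2 (lfloor m e),
     R3 (lfloor m d ** x_ c) & h = lfloor e d ** x_ m ** x_ c]].

Definition R5 : set L :=
  [set h | exists d1 d2 c m1 m2, [/\ dist d1 d2 = 2%N,
     R3 (lfloor c d1 ** x_ m1), R3 (lfloor c d2 ** x_ m2) &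
     h = lnprod (lfloor d1 d2 ** x_ c) (angle [:: m1; m2])]].

Definition R5' : set L :=
  [set h | exists d1 d2 c m m', [/\ dist d1 d2 = 2%N, R2 (lfloor c d1),
     R4 (lfloor c d2 ** x_ m ** x_ m'), dist m d1 <> 1%N &
     h = lfloor d1 d2 ** x_ c ** x_ m ** x_ m']].

End Cube.

Arguments cube_relations k _ : clear implicits.
Arguments R2 k _ : clear implicits.
Arguments R3 k _ : clear implicits.
Arguments R4 k _ : clear implicits.
Arguments R5 k _ : clear implicits.
Arguments R5' k _ : clear implicits.

(* Main.v *)
Require Import Defs.
From mathcomp Require Import all_boot all_order all_algebra.
From mathcomp Require Import boolp classical_sets.
From HB Require Import structures.
From mathcomp Require Import finmap multiset monalg ring.

(* The derived algebra of the free metabelian Lie algebra embeds, by the Magnus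
   map x |-> (t_x, e_x), into a free module over a commutative polynomial ring;
   there (p q) c1 ... cn becomes the monomial of its letters times
   e_p / t_p - e_q / t_q. Write this element [ldiff s p q], s being the multiset
   of letters: it is additive in (p, q), and for p > q its leading word begins
   with p. Hence Id(S) meets multidegree s in the span of the [ldiff s p q] with
   p and q in one component of the subgraph of the cube induced by s.
   Elements of S have no linear part, so only compositions of type I occur, and
   these are again of the form [ldiff t q' q] with q', q linked in t. To reduce
   such an element one needs, for every p in s linked to a smaller vertex, some
   [ldiff s0 p q] in S with s0 inside s and q < p: a shortest path from p to a
   smaller vertex is induced, induced paths of the cube have at most four edges,
   and those with 1, 2, 3, 4 edges give elements of R2, R3, R4, R5. *)

Set Implicit Arguments.
Unset Strict Implicit.
Unset Printing Implicit Defensive.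

Import Order.TTheory GRing.Theory.

Local Open Scope classical_set_scope.

(** * Universal property of the free metabelian Lie algebra *)

Section FreeMetabelianLift.
Variables (k : fieldType) (X : Type) (G : lieAlgType k) (g : X -> G).
Local Open Scope ring_scope.
Hypothesis metabG : forall x y z w : G, (x ** y) ** (z ** w) = 0.
Local Open Scope quotient_scope.

Fixpoint lterm_eval (t : lterm k X) : G :=
  match t with
  | TVar x => g x
  | TZero => 0
  | TAdd t u => lterm_eval t + lterm_eval u
  | TOpp t => - lterm_eval t
  | TScale c t => c *: lterm_eval t
  | TBr t u => lterm_eval t ** lterm_eval u
  end.

Lemma lcong_eval t u : lcong t u -> lterm_eval t = lterm_eval u.
Proof.
elim=> //=.
- by move=> t1 t2 t3 _ -> _ ->.
- by move=> t1 t2 t3 t4 _ -> _ ->.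
- by move=> t1 t2 _ ->.
- by move=> c t1 t2 _ ->.
- by move=> t1 t2 t3 t4 _ -> _ ->.
- by move=> *; rewrite addrA.
- by move=> *; rewrite addrC.
- by move=> *; rewrite add0r.
- by move=> *; rewrite addNr.
- by move=> *; rewrite scalerA.
- by move=> *; rewrite scale1r.
- by move=> *; rewrite scalerDr.
- by move=> *; rewrite scalerDl.
- by move=> *; rewrite lbr_linearl.
- by move=> *; rewrite lbr_linearr.
- by move=> *; rewrite lbrxx.
- by move=> *; rewrite lbr_jacobi.
Qed.

Let ev (f : free_lie k X) : G := lterm_eval (repr f).

Let evE t : ev (\pi_(free_lie k X) t) = lterm_eval t.
Proof. exact/lcong_eval/repr_free_lie. Qed.

Let evD : {morph ev : f h / f + h}.
Proof.
move=> f h; elim/quotW: f => f; elim/quotW: h => h.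
by rewrite -[_ + _]/(fl_add _ _) fl_addE !evE.
Qed.

Let evZ c : {morph ev : f / c *: f}.
Proof.
by move=> f; elim/quotW: f => f; rewrite -[_ *: _]/(fl_scale _ _) fl_scaleE !evE.
Qed.

Let evBr : {morph ev : f h / f ** h}.
Proof.
move=> f h; elim/quotW: f => f; elim/quotW: h => h.
by rewrite -[_ ** _]/(fl_br _ _) fl_brE !evE.
Qed.

Let ev0 : ev 0 = 0. Proof. by apply: (addrI (ev 0)); rewrite -evD !addr0. Qed.

Let ev_span A f : (forall h, A h -> ev h = 0) -> Defs.span A f -> ev f = 0.
Proof.
move=> A0 [n [c [v [Av ->]]]]; rewrite (big_morph _ evD ev0) big1 // => i _.
by rewrite evZ A0 ?scaler0.
Qed.

(** Expanding both factors bilinearly leaves brackets of two brackets, which [metabG] kills; hence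
    [ev] factors through the quotient [free_metab]. *)
Let ev_derived2 f : @derived k (free_lie k X) 2 f -> ev f = 0.
Proof.
apply: ev_span => _ [f1 + [f2 + <-]].
move=> [n1 [c1 [v1 [Av1 ->]]]] [n2 [c2 [v2 [Av2 ->]]]]; rewrite evBr.
rewrite !(big_morph _ evD ev0).
elim/big_rec: _ => [|i x _ IHx]; first by rewrite lbr0l.
rewrite lbrDl IHx addr0.
elim/big_rec: _ => [|j y _ IHy]; first by rewrite lbr0r.
rewrite lbrDr IHy addr0 !evZ lbrZl lbrZr.
have [a1 _ [b1 _ <-]] := Av1 i; have [a2 _ [b2 _ <-]] := Av2 j.
by rewrite !evBr metabG !scaler0.
Qed.

Definition metab_lift (f : free_metab k X) : G := ev (repr f).

Let metab_liftE f : metab_lift (\pi_(free_metab k X) f) = ev f.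
Proof.
have /ev_derived2 := repr_lie_quot (derivedI (free_lie k X) 2) f.
by rewrite -scaleN1r evD evZ scaleN1r => /eqP; rewrite subr_eq0 => /eqP.
Qed.

Lemma metab_lift_gen x : metab_lift (gen k x) = g x.
Proof. by rewrite metab_liftE evE. Qed.

Lemma metab_lift_linear : linear metab_lift.
Proof.
move=> c f h; elim/quotW: f => f; elim/quotW: h => h.
by rewrite -piZ -piD !metab_liftE evD evZ.
Qed.

Lemma metab_liftBr : {morph metab_lift : f h / f ** h}.
Proof.
move=> f h; elim/quotW: f => f; elim/quotW: h => h.
by rewrite -[X in metab_lift X]/(lq_br _ _) lq_brE !metab_liftE evBr.
Qed.

End FreeMetabelianLift.

(** * A metabelian Lie algebra of pairs, the target of the Magnus map *)

Definition affine_lie (k : fieldType) (B : comAlgType k) := (B * B)%type.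

Section AffineLie.
Variables (k : fieldType) (B : comAlgType k).
Local Open Scope ring_scope.

HB.instance Definition _ := GRing.Lmodule.on (affine_lie B).

(** Semidirect product: the first component is an abelian algebra [B] acting by multiplication on
    the second, the module [B] with zero bracket. *)
Definition affine_lbr (x y : affine_lie B) : affine_lie B :=
  (0, y.1 * x.2 - x.1 * y.2).

Let affine_lbrl c x y z :
  affine_lbr (c *: x + y) z = c *: affine_lbr x z + affine_lbr y z.
Proof.
congr pair; rewrite /= ?scaler0 ?addr0 // mulrDr mulrDl scalerBr -scalerAr -scalerAl.
by rewrite opprD addrACA.
Qed.

Let affine_lbrr c x y z :
  affine_lbr z (c *: x + y) = c *: affine_lbr z x + affine_lbr z y.
Proof.
congr pair; rewrite /= ?scaler0 ?addr0 // mulrDr mulrDl scalerBr -scalerAr -scalerAl.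
by rewrite opprD addrACA.
Qed.

Let affine_lbrxx x : affine_lbr x x = 0.
Proof. by rewrite /affine_lbr subrr. Qed.

Let affine_jacobi x y z :
  affine_lbr (affine_lbr x y) z + affine_lbr (affine_lbr y z) x
    + affine_lbr (affine_lbr z x) y = 0.
Proof. by congr pair; rewrite /= ?addr0 //; ring. Qed.

HB.instance Definition _ := Lmodule_isLieAlg.Build k (affine_lie B)
  affine_lbrl affine_lbrr affine_lbrxx affine_jacobi.

Lemma affine_lbrE (x y : affine_lie B) : x ** y = (0, y.1 * x.2 - x.1 * y.2).
Proof. by []. Qed.

Lemma affine_metab (x y z w : affine_lie B) : (x ** y) ** (z ** w) = 0.
Proof. by rewrite !affine_lbrE /= !mul0r subrr. Qed.

End AffineLie.

(** * The Magnus map and its values on words *)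

Section Magnus.
Context {k : fieldType} {disp : Order.disp_t} {X : orderType disp}.
Variables (B : comAlgType k) (t : X -> B).
Local Open Scope ring_scope.
Local Notation L := (free_metab k X).

(* The component at [y] of the Magnus embedding [x |-> (t x, e_x)] *)
Definition magnus (y : X) : L -> affine_lie B :=
  metab_lift (fun x => (t x, (x == y)%:R) : affine_lie B).

Lemma magnus_linear y : linear (magnus y).
Proof. exact/metab_lift_linear/affine_metab. Qed.

Lemma magnusBr y (f h : L) : magnus y (f ** h) = magnus y f ** magnus y h.
Proof. exact/metab_liftBr/affine_metab. Qed.

Lemma magnus_gen y x : magnus y (gen k x) = (t x, (x == y)%:R).
Proof. exact/metab_lift_gen/affine_metab. Qed.

(** An image with zero first component lies in the module part, where bracketing with a letter [a]
    is multiplication by [t a]. *)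
Lemma magnus_lnprod y (f : L) F u :
  magnus y f = (0, F) -> magnus y (lnprod f u) = (0, F * \prod_(x <- u) t x).
Proof.
elim: u f F => [|a u IHu] f F fF; first by rewrite big_nil mulr1.
have /IHu -> : magnus y (f ** gen k a) = (0, F * t a).
  by rewrite magnusBr magnus_gen fF affine_lbrE /= mul0r subr0 mulrC.
by rewrite big_cons mulrA.
Qed.

Lemma magnus_word y b c u :
  magnus y (word (b :: c :: u)) =
    (0, (\prod_(x <- c :: u) t x) *+ (b == y)
        - (\prod_(x <- b :: u) t x) *+ (c == y)).
Proof.
rewrite /= (@magnus_lnprod _ _ (t c *+ (b == y) - t b *+ (c == y))).
  by rewrite mulrBl !mulrnAl !big_cons.
by rewrite magnusBr !magnus_gen affine_lbrE /= !mulr_natr.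
Qed.

End Magnus.

(** * Linear independence of the regular words *)

Section RegularWordsIndependent.
Context {k : fieldType} {disp : Order.disp_t} {X : orderType disp}.
Local Open Scope ring_scope.
Local Notation L := (free_metab k X).
Local Notation B := {malg k[{cmonom X}]}.
Implicit Types (f g : L) (u v w s : seq X) (p q r : X).

Let tmon u : {cmonom X} := foldr (fun x m => mulcm (ucm x) m) (onecm X) u.

Let tmon_eq u v : (tmon u == tmon v) = perm_eq u v.
Proof.
have tmonE w x : tmon w x = count_mem x w.
  elim: w => [|a w IHw] /=; first exact: onecmE.
  by rewrite mulcmE IHw ucmE.
apply/cmP/idP => [uv|/permP uv x]; last by rewrite !tmonE uv.
by apply/allP => x _; rewrite /= -!tmonE uv.
Qed.

Let t (x : X) : B := << ucm x >>.

Let prod_t u : \prod_(x <- u) t x = << tmon u >>.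
Proof.
elim: u => [|a u IHu].
  by rewrite big_nil; apply/malgP => m; rewrite mcoeff1.
rewrite big_cons IHu /t malgM_def fgmulUU mulr1.
reflexivity.
Qed.

Let coef_t u v : (\prod_(x <- u) t x)@_(tmon v) = (perm_eq u v)%:R.
Proof. by rewrite prod_t mcoeffU tmon_eq; case: perm_eq. Qed.

(* Dual to the regular words: the second component of an image under Magnus   *)
(* at y, taken at the monomial u, detects exactly the word [y :: u]           *)
Definition rcoef w f : k :=
  if w is y :: u then (magnus t y f).2@_(tmon u) else 0.

Lemma rcoef_linear w c f h : rcoef w (c *: f + h) = c * rcoef w f + rcoef w h.
Proof.
case: w => [|y u] /=; first by rewrite mulr0 addr0.
by rewrite magnus_linear mcoeffD mcoeffZ.
Qed.

Lemma rcoef_sum w I (s : seq I) (c : I -> k) (F : I -> L) :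
  rcoef w (\sum_(i <- s) c i *: F i) = \sum_(i <- s) c i * rcoef w (F i).
Proof.
elim: s => [|i s IHs]; last by rewrite !big_cons rcoef_linear IHs.
by rewrite !big_nil; have := rcoef_linear w (-1) 0 0; rewrite scaler0 addr0 mulN1r addNr.
Qed.

(** The word [b :: c :: v] contributes the monomial of [c :: v] at [y = b], and minus that of
    [b :: v] at [y = c]. The first determines the sorted tail. The second would need a regular word
    with nonempty tail beginning with its least letter [c], and there is none. *)
Lemma rcoef_word w w' : in_N w -> in_N w' -> rcoef w (word w') = (w == w')%:R.
Proof.
case: w => [|y u] //; case: w' => [|b [|c v]] // Nw; rewrite [in_N _]/in_N.
  move=> _; rewrite /= magnus_gen /= mcoeffMn mcoeff1 eqseq_cons.
  have -> : (tmon u == mone) = (u == [::]).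
    by rewrite -[mone]/(tmon [::]) tmon_eq; apply/idP/eqP => [/perm_nilP|->].
  by rewrite [b == y]eq_sym; case: (y == b); rewrite ?mulr1n ?mulr0n.
rewrite /= => /andP[ltcb pcv]; rewrite magnus_word /= mcoeffB.
rewrite !mcoeffMn !coef_t eqseq_cons -!mulrnA !mulnb ![_ && (_ == y)]andbC.
have -> : (c == y) && perm_eq (b :: v) u = false.
  apply/negP => /andP[/eqP cy /perm_mem bvu].
  move: Nw; rewrite /in_N /in_X /= eqSS size_eq0; case: u bvu => [|a u] bvu /=.
    by have := bvu b; rewrite !inE eqxx.
  move=> /andP[+ _]; apply/negP; rewrite -leNgt -cy.
  have : a \in b :: v by rewrite bvu mem_head.
  rewrite inE => /orP[/eqP->|]; first exact: ltW.
  by apply/allP; apply: order_path_min pcv; apply: le_trans.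
rewrite mulr0n subr0 /= eq_sym; case: eqP => [yb|_] //=.
congr (_%:R); congr nat_of_bool.
have {}Nw : sorted <=%O u.
  move: Nw; rewrite /in_N /in_X /= eqSS size_eq0; case: u => //= a u.
  by case/andP.
apply/idP/eqP => [|->]; last exact: perm_refl.
by move=> /(sorted_eq le_trans le_anti (pcv : sorted _ (c :: v)) Nw) <-.
Qed.

End RegularWordsIndependent.

(** * Coordinates over the regular words and uniqueness of leading words *)

Section LeadingWords.
Context {k : fieldType} {disp : Order.disp_t} {X : orderType disp}.
Local Open Scope ring_scope.
Local Notation L := (free_metab k X).
Implicit Types (f g h : L) (u v w s : seq X) (p q r a : X).

Local Notation coefN := Defs.coefN.

(** The dual functional [rcoef w] isolates the coefficient of [w], so an element has at most one
    expansion. *)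
Lemma expands_coef f c w : expands f c -> c w = if in_N w then rcoef w f else 0.
Proof.
case=> Nc ->; case: ifP => [Nw|/negP Nw]; last first.
  by case: (finsuppP c w) => // /Nc.
rewrite rcoef_sum big_seq.
under eq_bigr => v vc do rewrite (rcoef_word Nw (Nc _ vc)).
rewrite -big_seq; case: (finsuppP c w) => [wc|wc].
  rewrite big_seq big1 // => v vc.
  by case: eqP vc wc => [<- ->|]; rewrite ?mulr0.
rewrite (big_fsetD1 w) //= eqxx mulr1 big_seq big1 ?addr0 // => v.
by rewrite !inE eq_sym => /andP[/negPf ->]; rewrite mulr0.
Qed.

Lemma coefNE f c w : expands f c -> coefN f w = if in_N w then rcoef w f else 0.
Proof. by move=> fc; apply: expands_coef; apply: (xgetPex [fsfun]); exists c. Qed.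

(** [coefN] chooses an expansion, so one must be exhibited before it can be computed. The words
    [F i] may repeat; therefore the coefficients are collected by [rcoef] instead of being copied
    from [c]. *)
Lemma expands_sum (I : eqType) (s : seq I) (c : I -> k) (F : I -> seq X)
    (f := \sum_(i <- s) c i *: word (F i) : L) :
  {in s, forall i, in_N (F i)} ->
  expands f [fsfun w in [fset w | w in map F s]%fset => rcoef w f].
Proof.
move=> NF; set A := [fset w | w in _]%fset.
have NA w : w \in A -> in_N w by rewrite !inE => /mapP[i /NF + ->].
split=> [w|].
  by move=> /(fsubsetP (finsupp_sub _ _ _)); apply: NA.
rewrite [RHS](big_fset_incl _ (finsupp_sub _ _ _)) /=; last first.
  by move=> w _; case: finsuppP => // _ _; rewrite scale0r.
rewrite big_seq; under eq_bigr => w wA do rewrite fsfunE wA rcoef_sum scaler_suml.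
rewrite -big_seq exchange_big /= /f [LHS]big_seq [RHS]big_seq; apply: eq_bigr => i si.
have FiA : F i \in A by rewrite !inE map_f.
rewrite (big_fsetD1 (F i)) //= rcoef_word ?NF // eqxx mulr1 big_seq big1 ?addr0 // => w.
by rewrite in_fsetD1 => /andP[/negPf wFi wA]; rewrite rcoef_word ?NA ?NF // wFi mulr0 scale0r.
Qed.

Lemma coefN_sum (I : eqType) (s : seq I) (c : I -> k) (F : I -> seq X) w :
  {in s, forall i, in_N (F i)} ->
  coefN (\sum_(i <- s) c i *: word (F i) : L) w = \sum_(i <- s | F i == w) c i.
Proof.
move=> NF; rewrite (coefNE _ (expands_sum c NF)) [RHS]big_mkcond /=.
case: ifP => [Nw|/negP Nw]; last first.
  by rewrite big_seq big1 // => i si; case: eqP => // Fiw; case: Nw; rewrite -Fiw NF.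
rewrite rcoef_sum [LHS]big_seq [RHS]big_seq; apply: eq_bigr => i si.
rewrite rcoef_word ?NF // eq_sym.
by case: eqP; rewrite ?mulr1 ?mulr0.
Qed.

Lemma coefN0 w : coefN (0 : L) w = 0.
Proof.
have := @coefN_sum void [::] (fun=> 0) (fun=> [::]) w.
by rewrite !big_nil; apply.
Qed.

Lemma wle_anti u v : wle u v -> wle v u -> u = v.
Proof.
rewrite /wle eq_sym; case: eqP => // _ /=; rewrite /wlt [size v == _]eq_sym.
case: ltngtP => //= _ uv vu.
by have := lt_trans uv vu; rewrite ltxx.
Qed.

Lemma is_lead_uniq f u v : is_lead f u -> is_lead f v -> u = v.
Proof. by move=> [fu ub_u] [fv ub_v]; apply: wle_anti; [apply: ub_v | apply: ub_u]. Qed.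

Lemma is_lead0 w : ~ is_lead (0 : L) w.
Proof. by case; rewrite mem_finsupp coefN0 eqxx. Qed.

End LeadingWords.

(** * Products with given letters as formal differences of two letters *)

Section LetterDifferences.
Context {k : fieldType} {disp : Order.disp_t} {X : orderType disp}.
Local Open Scope ring_scope.
Local Open Scope quotient_scope.
Local Notation L := (free_metab k X).
Local Notation x_ := (@gen k X).
Local Notation coefN := Defs.coefN.
Implicit Types (f g h : L) (u v w s t : seq X) (p q r a : X).

Lemma metabelian f g h f' : (f ** g) ** (h ** f') = 0.
Proof.
elim/quotW: f => f; elim/quotW: g => g; elim/quotW: h => h; elim/quotW: f' => f'.
rewrite -[LHS]/(lq_br (lq_br _ _) (lq_br _ _)) !lq_brE.
apply/lie_quotP/asboolP; rewrite subr0.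
by apply: span_sub; exists (f ** g); [|exists (h ** f') => //];
  apply: span_sub; [exists f => //; exists g | exists h => //; exists f'].
Qed.

Lemma lnprod_linear u c f g : lnprod (c *: f + g) u = c *: lnprod f u + lnprod g u.
Proof. by elim: u f g => //= a u IHu f g; rewrite lbr_linearl IHu. Qed.

Lemma lnprod0 u : lnprod (0 : L) u = 0.
Proof. by elim: u => //= a u IHu; rewrite lbr0l. Qed.

Lemma lnprodD u f g : lnprod (f + g) u = lnprod f u + lnprod g u.
Proof. by rewrite -[f]scale1r lnprod_linear !scale1r. Qed.

Lemma lnprodN u f : lnprod (- f) u = - lnprod f u.
Proof. by rewrite -scaleN1r -[_ *: f]addr0 lnprod_linear lnprod0 addr0 scaleN1r. Qed.

Lemma lnprod_cat f u v : lnprod f (u ++ v) = lnprod (lnprod f u) v.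
Proof. exact: foldl_cat. Qed.

(** Letters multiplied onto a bracket commute, since $(fg)ab-(fg)ba=(fg)(ab)=0$. *)
Lemma lnprod_perm f g u v :
  perm_eq u v -> lnprod (f ** g) u = lnprod (f ** g) v.
Proof.
have mid a v1 v2 f' g' :
    lnprod (f' ** g') (v1 ++ a :: v2) = lnprod (f' ** g' ** x_ a) (v1 ++ v2).
  elim: v1 f' g' => //= b v1 IHv f' g'; rewrite IHv; congr lnprod.
  by rewrite lbr_leibniz metabelian add0r.
elim: u v f g => [|a u IHu] v f g; first by rewrite perm_sym => /perm_nilP->.
move=> uv; have /path.splitPr uv' : a \in v by rewrite -(perm_mem uv) mem_head.
case: uv' uv => v1 v2; rewrite perm_sym perm_catC cat_cons perm_cons perm_catC.
by move=> uv; rewrite mid /=; apply: IHu; rewrite perm_sym.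
Qed.

(** The list [s] stands for a multiset: each [rem] takes away one occurrence. When [p = q] the
    second [rem] may find nothing, which is harmless because the bracket is then 0. *)
Definition ldiff s p q : L := lnprod (x_ p ** x_ q) (rem q (rem p s)).

Lemma ldiffxx s p : ldiff s p p = 0.
Proof. by rewrite /ldiff lbrxx lnprod0. Qed.

Lemma ldiff_perm s s' p q : perm_eq s s' -> ldiff s p q = ldiff s' p q.
Proof.
have rem_perm x u v : perm_eq u v -> perm_eq (rem x u) (rem x v).
  move=> uv; have [xu|xu] := boolP (x \in u); last first.
    by rewrite !rem_id // -(perm_mem uv).
  rewrite -(perm_cons x) -(permPl (perm_to_rem xu)) (permPl uv).
  by apply: perm_to_rem; rewrite -(perm_mem uv).
by move=> ss'; apply/lnprod_perm/rem_perm/rem_perm.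
Qed.

Lemma ldiffE p q t : ldiff (p :: q :: t) p q = lnprod (x_ p ** x_ q) t.
Proof. by rewrite /ldiff /= eqxx /= eqxx. Qed.

Lemma perm_to_rem2 s p q :
  p != q -> p \in s -> q \in s -> perm_eq s (p :: q :: rem q (rem p s)).
Proof.
move=> pq ps qs; apply: perm_trans (perm_to_rem ps) _; rewrite perm_cons.
apply: perm_to_rem; move: qs; rewrite (perm_mem (perm_to_rem ps)) inE.
by rewrite [q == p]eq_sym (negPf pq).
Qed.

Lemma ldiffC s p q : p \in s -> q \in s -> ldiff s q p = - ldiff s p q.
Proof.
have [-> _ _|pq ps qs] := eqVneq p q; first by rewrite !ldiffxx oppr0.
have := perm_to_rem2 pq ps qs; set t := rem _ _ => st.
rewrite !(ldiff_perm _ _ st) ldiffE -lnprodN -lbrC.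
rewrite (@ldiff_perm _ (q :: p :: t)) ?ldiffE //.
by apply/permP => a /=; rewrite addnCA.
Qed.

Lemma ldiff_cat s u p q : p \in s -> q \in s -> lnprod (ldiff s p q) u = ldiff (s ++ u) p q.
Proof.
have [-> _ _|pq ps qs] := eqVneq p q; first by rewrite !ldiffxx lnprod0.
have := perm_to_rem2 pq ps qs; set t := rem _ _ => st.
rewrite (ldiff_perm _ _ st) ldiffE -lnprod_cat.
by rewrite (@ldiff_perm _ (p :: q :: t ++ u)) ?ldiffE // -!cat_cons perm_cat2r.
Qed.

(** For three distinct letters this is the Jacobi identity $(pq)r+(qr)p=(pr)q$ multiplied by the
    remaining letters. *)
Lemma ldiff_add s p q r :
  p \in s -> q \in s -> r \in s -> ldiff s p q + ldiff s q r = ldiff s p r.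
Proof.
move=> ps qs rs.
have [<-|pq] := eqVneq p q; first by rewrite ldiffxx add0r.
have [<-|qr] := eqVneq q r; first by rewrite ldiffxx addr0.
have [<-|pr] := eqVneq p r; first by rewrite (ldiffC ps qs) ldiffxx subrr.
have := perm_to_rem2 pq ps qs; set t := rem _ _ => st.
have rt : r \in t.
  by have := perm_mem st r; rewrite rs !inE [r == p]eq_sym [r == q]eq_sym (negPf pr) (negPf qr).
have {t st rt} [t st] : exists t, perm_eq s [:: p, q, r & t].
  exists (rem r t); apply: perm_trans st _; rewrite !perm_cons; exact: perm_to_rem.
rewrite !(ldiff_perm _ _ st) ldiffE.
rewrite (@ldiff_perm _ [:: q, r, p & t]); last first.
  by apply/permP => a /=; rewrite addnCA; congr addn; rewrite addnCA.
rewrite (@ldiff_perm _ [:: p, r, q & t] p r); last first.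
  by apply/permP => a /=; congr addn; rewrite addnCA.
rewrite !ldiffE /= -lnprodD; congr lnprod.
have /eqP := lbr_jacobi (x_ p) (x_ q) (x_ r).
by rewrite addr_eq0 [x_ r ** _]lbrC lbrNl opprK => /eqP.
Qed.

Definition rword s p : seq X := p :: sort <=%O (rem p s).

Lemma size_rword s p : p \in s -> size (rword s p) = size s.
Proof. by move=> ps; rewrite /= size_sort (perm_size (perm_to_rem ps)). Qed.

Lemma perm_rword s p : p \in s -> perm_eq (rword s p) s.
Proof.
move=> ps; rewrite perm_sym; apply: perm_trans (perm_to_rem ps) _.
by rewrite perm_cons perm_sym perm_sort.
Qed.

Lemma rword_wlt s p q : p \in s -> q \in s -> (p < q)%O -> wlt (rword s p) (rword s q).
Proof.
move=> ps qs pq; rewrite /wlt !size_rword // eqxx ltnn /=.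
by rewrite ltxi_cons (ltW pq) leNgt pq.
Qed.

(** With the least letter [m] in second place the product is already a regular word. Passing through
    [m] thus writes every [ldiff s p q] in the basis. *)
Lemma ldiff_min s m q : m \in s -> all (>= m)%O s -> q \in s ->
  in_R (rword s q) = (q != m) /\ ldiff s q m = if q == m then 0 else word (rword s q).
Proof.
move=> ms /allP min_m qs; rewrite /rword.
case: eqP => [qm|/eqP qm].
  split; last by rewrite qm ldiffxx.
  rewrite /= ; case E: (sort _ _) => [|a u] //=.
  rewrite qm ltNge min_m //.
  by have := mem_head a u; rewrite -E mem_sort => /mem_rem.
have st := perm_to_rem2 qm qs ms.
have -> : sort <=%O (rem q s) = m :: sort <=%O (rem m (rem q s)).
  apply: (sorted_eq le_trans le_anti); first exact: sort_le_sorted.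
    rewrite /= path_min_sorted; first exact: sort_le_sorted.
    by apply/allP => a; rewrite mem_sort => /mem_rem/mem_rem; apply: min_m.
  rewrite perm_sort perm_sym.
  have: perm_eq (m :: rem m (rem q s)) (rem q s).
    by rewrite -(perm_cons q); apply: perm_trans (perm_to_rem qs); rewrite perm_sym.
  by apply: perm_trans; rewrite perm_cons perm_sort.
split.
  rewrite /= lt_neqAle eq_sym qm min_m //= path_min_sorted; first exact: sort_le_sorted.
  by apply/allP => a; rewrite mem_sort => /mem_rem/mem_rem; apply: min_m.
rewrite (ldiff_perm _ _ st) ldiffE /=; apply: lnprod_perm.
by rewrite perm_sym perm_sort.
Qed.

Lemma seq_min s p : p \in s -> exists2 m, m \in s & all (>= m)%O s.
Proof.
move=> ps; case E: (sort <=%O s) (sort_le_sorted s) => [|m u].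
  by move: ps; rewrite -(mem_sort <=%O) E.
move=> /(order_path_min le_trans) min_m; exists m.
  by rewrite -(mem_sort <=%O) E mem_head.
by rewrite -(all_sort _ <=%O) E /= lexx.
Qed.

(** By additivity the element is [ldiff s p m - ldiff s q m], with [m] the least letter. The test
    [in_R w] drops the second word when [q = m], for then [rword s q] is not regular and its term is
    0. *)
Lemma coefN_ldiff s p q w : p \in s -> q \in s -> (q < p)%O ->
  coefN (ldiff s p q) w = (w == rword s p)%:R - (in_R w && (w == rword s q))%:R.
Proof.
move=> ps qs qp; have [m ms min_m] := seq_min ps.
have [Rp pE] := ldiff_min ms min_m ps; have [Rq qE] := ldiff_min ms min_m qs.
have pm : p != m.
  by apply: contraTneq qp => ->; rewrite -leNgt; apply: (allP min_m).
rewrite -(ldiff_add ps ms qs) (ldiffC qs ms) pE qE (negPf pm).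
rewrite pm in Rp; case: eqP Rq => [_|_] Rq.
  have -> : word (rword s p) - 0 = \sum_(v <- [:: rword s p]) 1 *: word v :> L.
    by rewrite big_seq1 scale1r subr0.
  rewrite coefN_sum => [|v]; last first.
    by rewrite inE => /eqP->; rewrite /in_N Rp orbT.
  rewrite big_mkcond big_seq1 eq_sym; case: eqP => [->|_].
    by case: eqP => [pq|]; rewrite ?andbF ?subr0 ?addr0 // pq Rq subr0.
  by case: eqP => [->|]; rewrite ?Rq ?andbF subrr.
have -> : word (rword s p) - word (rword s q) =
    \sum_(i <- [:: (1, rword s p); (-1, rword s q)]) i.1 *: word i.2 :> L.
  by rewrite big_cons big_seq1 scale1r scaleN1r.
rewrite coefN_sum => [|v]; last first.
  by rewrite !inE => /orP[]/eqP->; rewrite /in_N ?Rp ?Rq orbT.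
rewrite big_mkcond big_cons big_seq1 /=.
rewrite [_ == w]eq_sym [rword s q == w]eq_sym.
have -> : in_R w && (w == rword s q) = (w == rword s q).
  by case: eqP => [->|]; rewrite ?Rq ?andbF.
by case: eqP => _; case: eqP => _; rewrite ?addr0 ?subr0 ?add0r // sub0r.
Qed.

End LetterDifferences.

(** * Leading words and compositions of the differences *)

Section LetterDifferenceLeads.
Context {k : fieldType} {disp : Order.disp_t} {X : orderType disp}.
Local Open Scope ring_scope.
Local Notation L := (free_metab k X).
Local Notation coefN := Defs.coefN.
Local Notation ldiff := (@ldiff k disp X).
Implicit Types (f g h : L) (u v w s t : seq X) (p q r a : X).

Lemma finsupp_ldiff s p q w : p \in s -> q \in s -> (q < p)%O ->
  (w \in finsupp (coefN (ldiff s p q))) = (w == rword s p) || in_R w && (w == rword s q).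
Proof.
move=> ps qs qp; rewrite mem_finsupp coefN_ldiff //.
case: (eqVneq w (rword s p)) => [->|wp] /=; last first.
  by rewrite sub0r oppr_eq0; case: (_ && _); rewrite ?oner_eq0 ?eqxx.
rewrite [_ == rword s q]eqseq_cons (gt_eqF qp) /= andbF subr0 oner_eq0.
by [].
Qed.

Lemma coefN_ldiff_lead s p q : p \in s -> q \in s -> (q < p)%O ->
  coefN (ldiff s p q) (rword s p) = 1.
Proof.
move=> ps qs qp; rewrite coefN_ldiff // eqxx eqseq_cons (gt_eqF qp) andbF.
by rewrite subr0.
Qed.

Lemma is_lead_ldiff s p q : p \in s -> q \in s -> (q < p)%O ->
  is_lead (ldiff s p q) (rword s p).
Proof.
move=> ps qs qp; split=> [|w]; rewrite finsupp_ldiff ?eqxx //.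
by case/orP => [/eqP->|/andP[_ /eqP->]]; rewrite /wle ?eqxx // rword_wlt ?orbT.
Qed.

(** Two distinct letters of [s] give every word at least two letters. *)
Lemma part0_ldiff s p q : p \in s -> q \in s -> (q < p)%O -> part0 (ldiff s p q) = 0.
Proof.
move=> ps qs qp; rewrite /part0 big_seq_cond big_pred0 // => w.
rewrite finsupp_ldiff //; apply/negP => /andP[].
have size2 r : r \in s -> in_X (rword s r) = false.
  rewrite /in_X => rs; rewrite size_rword // (perm_size (perm_to_rem2 _ ps qs)) //.
  by rewrite gt_eqF.
by case/orP => [/eqP->|/andP[_ /eqP->]]; rewrite size2.
Qed.

Lemma ldiff_neq0 s p q : p \in s -> q \in s -> (q < p)%O -> ldiff s p q <> 0.
Proof. by move=> ps qs /(is_lead_ldiff ps qs) + E; rewrite E => /is_lead0. Qed.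

Lemma rword_inj s t p q : p \in s -> q \in t -> rword s p = rword t q ->
  p = q /\ perm_eq s t.
Proof.
move=> ps qt E; split; first by case: E.
by rewrite -(permPl (perm_rword ps)) E perm_rword.
Qed.

(** The leading word gives back [p] and the multiset; then [ldiff s q q'] vanishes, which forces
    [q = q']. This lets conditions imposed on elements, such as [R2 (lfloor m e)], be read as
    conditions on vertices. *)
Lemma ldiff_inj s p q s' p' q' :
  p \in s -> q \in s -> (q < p)%O -> p' \in s' -> q' \in s' -> (q' < p')%O ->
  ldiff s p q = ldiff s' p' q' -> [/\ perm_eq s s', p = p' & q = q'].
Proof.
move=> ps qs qp ps' qs' qp' E.
have := is_lead_ldiff ps qs qp; rewrite E => /is_lead_uniq/(_ (is_lead_ldiff ps' qs' qp')).
case/(rword_inj ps ps') => pp' ss'; split=> //; move: E; rewrite -pp'.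
rewrite -(ldiff_perm _ _ ss') => E.
have {}qs' : q' \in s by rewrite (perm_mem ss').
have E0 : ldiff s q q' = 0.
  by rewrite -(ldiff_add qs ps qs') (ldiffC ps qs) E addNr.
have E0' : ldiff s q' q = 0 by rewrite (ldiffC qs qs') E0 oppr0.
by case: (ltgtP q q') => // [/(ldiff_neq0 qs' qs)|/(ldiff_neq0 qs qs')].
Qed.

Lemma perm_mdiv_mlcm u v : perm_eq (u ++ mdiv (mlcm u v) u) (mlcm u v).
Proof.
apply/allP => x _ /=; rewrite count_cat /mlcm /mdiv /angle.
rewrite !(permP (permEl (perm_sort _ _))) !count_mem_mset.
rewrite !msetE2 !mset_seqE (permP (permEl (perm_sort _ _))) count_mem_mset.
by rewrite msetE2 !mset_seqE subnKC // leq_maxl.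
Qed.

Lemma mlcmC u v : mlcm u v = mlcm v u.
Proof. by rewrite /mlcm msetUC. Qed.

(** Type I multiplies both elements up to the same multiset [t], and [p] cancels:
    [ldiff t p q - ldiff t p q'] is [ldiff t q' q]. *)
Lemma composition_ldiff s p q s' p' q' w h :
  p \in s -> q \in s -> (q < p)%O -> p' \in s' -> q' \in s' -> (q' < p')%O ->
  composition (ldiff s p q) (ldiff s' p' q') w h ->
  exists t, [/\ p' = p, {subset s <= t}, {subset s' <= t}, w = rword t p &
                h = ldiff t q' q].
Proof.
move=> ps qs qp ps' qs' qp'.
have part0g := part0_ldiff ps' qs' qp'.
(* Types II to VII all require a leading word of [part0] of the second element, which is 0. *)
case; try by move=> *;
  match goal with H : is_lead (part0 (ldiff s' p' q')) _ |- _ => 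
    by move: H; rewrite part0g => /is_lead0 end.
move=> a0 u v /is_lead_uniq/(_ (is_lead_ldiff ps qs qp)) [ap ->].
move=> /is_lead_uniq/(_ (is_lead_ldiff ps' qs' qp')) [ap' ->] _.
rewrite ap; rewrite ap in ap'; move: ps' qs' qp' part0g; rewrite -ap' => {ap ap'} ps' qs' qp' _.
set u0 := sort _ _; set v0 := sort _ _; set l := mlcm _ _.
have st : perm_eq (s ++ mdiv l u0) (p :: l).
  rewrite -(permPl (perm_cat (perm_rword ps) (perm_refl _))) /= perm_cons.
  exact: perm_mdiv_mlcm.
have st' : perm_eq (s' ++ mdiv l v0) (p :: l).
  rewrite -(permPl (perm_cat (perm_rword ps') (perm_refl _))) /= perm_cons.
  by rewrite /l mlcmC; apply: perm_mdiv_mlcm.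
exists (p :: l); split=> //.
- by move=> x xs; rewrite -(perm_mem st) mem_cat xs.
- by move=> x xs; rewrite -(perm_mem st') mem_cat xs.
- rewrite /rword /= eqxx /l /mlcm /angle; congr cons.
  by rewrite [RHS](sorted_sort le_trans) ?sort_le_sorted.
rewrite !ldiff_cat // (ldiff_perm _ _ st) (ldiff_perm _ _ st').
have pt : p \in p :: l by rewrite mem_head.
have qt : q \in p :: l by rewrite -(perm_mem st) mem_cat qs.
have qt' : q' \in p :: l by rewrite -(perm_mem st') mem_cat qs'.
by rewrite -(ldiff_add qt' pt qt) (ldiffC pt qt') addrC.
Qed.

End LetterDifferenceLeads.

(** * Distances in the cube *)

Section CubeDistance.
Implicit Types (x y z w : V3).

Lemma distE x y : dist x y =
  ((tnth x ord0 != tnth y ord0) + (tnth x (lift ord0 ord0) != tnth y (lift ord0 ord0))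
   + (tnth x ord_max != tnth y ord_max))%N.
Proof.
have neqE (a b : bool) : absz ((a : nat)%:Z - (b : nat)%:Z)%R = (a != b) by case: a; case: b.
rewrite /dist !big_ord_recl big_ord0 addn0 addnA !neqE.
by congr ((_ + (tnth x _ != tnth y _)) + (tnth x _ != tnth y _))%N; apply: val_inj.
Qed.

Lemma distC x y : dist x y = dist y x.
Proof. by rewrite !distE ![tnth x _ == _]eq_sym. Qed.

Lemma distxx x : dist x x = 0%N.
Proof. by rewrite distE !eqxx. Qed.

Lemma dist0_eq x y : dist x y = 0%N -> x = y.
Proof.
rewrite distE => d0; apply: eq_from_tnth => i.
suff: tnth x i == tnth y i by move/eqP.
have [->|->|->] : [\/ i = ord0, i = lift ord0 ord0 | i = ord_max].
  by case: i => [[|[|[|//]]] ?]; [constructor 1|constructor 2|constructor 3]; apply: val_inj.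
all: by case: eqP d0 => //; case: eqP; case: eqP.
Qed.

(** Crossing an edge changes exactly one coordinate, so it changes the distance to [x] by exactly
    one. *)
Lemma dist_step2 x y z : dist x y = 1%N -> dist y z = 1%N -> dist x z = 0%N \/ dist x z = 2.
Proof.
rewrite !distE.
by do 3!case: (tnth x _); do 3!case: (tnth y _) => //; do 3!case: (tnth z _) => //; auto.
Qed.

Lemma dist_step3 x y z : dist x y = 2 -> dist y z = 1%N -> dist x z = 1%N \/ dist x z = 3.
Proof.
rewrite !distE.
by do 3!case: (tnth x _); do 3!case: (tnth y _) => //; do 3!case: (tnth z _) => //; auto.
Qed.

(** As [x] and [y] are antipodal, [z] differs from [x] exactly where it agrees with [y]. *)
Lemma dist_antipode x y z d : dist x y = 3 -> dist y z = d -> dist x z = (3 - d)%N.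
Proof.
rewrite !distE.
by do 3!case: (tnth x _); do 3!case: (tnth y _) => //; (do 3!case: (tnth z _)) => _ <-.
Qed.

End CubeDistance.

(** * Connectivity in the subgraph induced by the letters of a list *)

Section Linked.
Implicit Types (s t : seq V3) (p q r x y : V3).

Definition cube_edge s : rel V3 :=
  [rel x y | [&& x \in s, y \in s & dist x y == 1%N]].

(** [connect] is reflexive on all of [V3], hence the separate membership tests. *)
Definition linked s p q : bool := [&& p \in s, q \in s & connect (cube_edge s) p q].

Lemma linked_memr s p q : linked s p q -> q \in s.
Proof. by case/and3P. Qed.

Lemma linked_meml s p q : linked s p q -> p \in s.
Proof. by case/and3P. Qed.

Lemma linked_sym s p q : linked s p q = linked s q p.
Proof.
rewrite /linked andbCA; congr [&& _, _ & _]; apply: sym_connect_sym => x y /=.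
by rewrite /cube_edge /= andbCA distC.
Qed.

Lemma linked_trans s p q r : linked s p q -> linked s q r -> linked s p r.
Proof.
case/and3P=> ps _ pq /and3P[_ rs qr].
by rewrite /linked ps rs; apply: connect_trans pq qr.
Qed.

Lemma linked_edge s p q : p \in s -> q \in s -> dist p q = 1%N -> linked s p q.
Proof.
move=> ps qs pq; rewrite /linked ps qs; apply: connect1.
by rewrite /cube_edge /= ps qs pq.
Qed.

(** The inclusion is a boolean [all], so that for explicit lists it is settled by rewriting. *)
Lemma linked_sub s t p q : all (mem t) s -> linked s p q -> linked t p q.
Proof.
move=> /allP st0 /and3P[ps qs pq]; have st : {subset s <= t} := st0.
rewrite /linked !st //=.
apply: connect_sub pq => x y; rewrite /cube_edge /= => /and3P[xs ys xy].
by apply: connect1; rewrite /= !st.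
Qed.

Lemma linked_perm s t p q : perm_eq s t -> linked s p q = linked t p q.
Proof.
move=> st; apply/idP/idP; apply: linked_sub; apply/allP => x.
  by rewrite /= (perm_mem st).
by rewrite /= (perm_mem st).
Qed.

End Linked.

(** * Elements of [S] as linked differences, and their membership in the ideal *)

Section CubeElements.
Variable k : fieldType.
Local Open Scope ring_scope.
Local Notation L := (free_metab k V3).
Local Notation ldiff := (@ldiff k _ V3).
Local Notation lfloor := (@lfloor k).
Local Notation x_ := (@gen k V3).
Implicit Types (f g h : L) (s t u : seq V3) (p q r e d : V3).

(** The common shape of the elements of all five sets; [q < p] fixes the sign and makes the leading
    coefficient 1. *)
Definition linked_diff f : Prop :=
  exists s p q, [/\ linked s p q, (q < p)%O & f = ldiff s p q].

Lemma lnprod_lfloor e d u : e != d ->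
  lnprod (lfloor e d) u = ldiff [:: e, d & u] (Order.max e d) (Order.min e d).
Proof.
move=> ed; rewrite /Defs.lfloor.
case: (ltgtP e d) => [lt_ed|lt_de|E]; last by rewrite E eqxx in ed.
  rewrite (@ldiff_perm _ _ _ [:: e, d & u] [:: d, e & u]) ?ldiffE //.
  by apply/permP => a /=; rewrite addnCA.
by rewrite ldiffE.
Qed.

(** The forward direction starts from unknown witnesses [s], [p], [q]; [ldiff_inj] identifies them
    with the visible letters. *)
Lemma linked_diff_lnprod e d u :
  linked_diff (lnprod (lfloor e d) u) <-> e != d /\ linked [:: e, d & u] e d.
Proof.
have minmax : e != d -> (Order.min e d < Order.max e d)%O.
  by case: (ltgtP e d) => // ->; rewrite eqxx.
have link : linked [:: e, d & u] (Order.max e d) (Order.min e d) = linked [:: e, d & u] e d.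
  by case: (ltgtP e d) => [_|_|->] //; rewrite linked_sym.
split=> [[s [p [q [spq qp]]]]|[ed edu]].
  have [ps qs] := (linked_meml spq, linked_memr spq).
  have [->|ed] := eqVneq e d.
    by rewrite /Defs.lfloor lbrxx lnprod0 => /esym/(ldiff_neq0 ps qs qp).
  rewrite lnprod_lfloor // => E; split=> //; rewrite -link.
  have [] := ldiff_inj _ _ (minmax ed) ps qs qp E.
  - by case: (ltgtP e d); rewrite !inE eqxx ?orbT.
  - by case: (ltgtP e d); rewrite !inE eqxx ?orbT.
  by move=> /linked_perm-> -> ->.
exists [:: e, d & u], (Order.max e d), (Order.min e d).
by split; [rewrite link | apply: minmax | rewrite lnprod_lfloor].
Qed.

Lemma dist_neq n e d : dist e d = n.+1 -> e != d.
Proof. by apply: contra_eq_neq => ->; rewrite distxx. Qed.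

Lemma R2_linked f : R2 k f -> linked_diff f.
Proof.
move=> [e [d [ed ->]]]; apply/(linked_diff_lnprod e d [::]).
by split; [apply: dist_neq ed | apply: linked_edge; rewrite ?inE ?eqxx ?orbT].
Qed.

(** The shorter elements named in the definition link both ends to the intermediate letter [m]. The
    larger sets follow the same scheme. *)
Lemma R3_linked f : R3 k f -> linked_diff f.
Proof.
move=> [e [d [m [ed /R2_linked me /R2_linked md ->]]]].
apply/(linked_diff_lnprod e d [:: m]); split; first exact: dist_neq ed.
have [_ {}me] := (linked_diff_lnprod m e [::]).1 me.
have [_ {}md] := (linked_diff_lnprod m d [::]).1 md.
apply: (@linked_trans _ _ m); first (rewrite linked_sym; move: me).
  by apply: linked_sub; rewrite /= !inE !eqxx ?orbT.
by move: md; apply: linked_sub; rewrite /= !inE !eqxx ?orbT.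
Qed.

Lemma R4_linked f : R4 k f -> linked_diff f.
Proof.
move=> [e [d [m [c [ed /R2_linked me /R3_linked md ->]]]]].
apply/(linked_diff_lnprod e d [:: m; c]); split; first exact: dist_neq ed.
have [_ {}me] := (linked_diff_lnprod m e [::]).1 me.
have [_ {}md] := (linked_diff_lnprod m d [:: c]).1 md.
apply: (@linked_trans _ _ m); first (rewrite linked_sym; move: me).
  by apply: linked_sub; rewrite /= !inE !eqxx ?orbT.
by move: md; apply: linked_sub; rewrite /= !inE !eqxx ?orbT.
Qed.

Lemma R5_linked f : R5 k f -> linked_diff f.
Proof.
move=> [d1 [d2 [c [m1 [m2 [d12 /R3_linked cd1 /R3_linked cd2 ->]]]]]].
apply/(linked_diff_lnprod d1 d2 (c :: angle [:: m1; m2])); split; first exact: dist_neq d12.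
have [_ {}cd1] := (linked_diff_lnprod c d1 [:: m1]).1 cd1.
have [_ {}cd2] := (linked_diff_lnprod c d2 [:: m2]).1 cd2.
apply: (@linked_trans _ _ c); first (rewrite linked_sym; move: cd1).
  by apply: linked_sub; rewrite /= !inE !mem_sort !inE !eqxx ?orbT.
by move: cd2; apply: linked_sub; rewrite /= !inE !mem_sort !inE !eqxx ?orbT.
Qed.

Lemma R5'_linked f : R5' k f -> linked_diff f.
Proof.
move=> [d1 [d2 [c [m [m' [d12 /R2_linked cd1 /R4_linked cd2 _ ->]]]]]].
apply/(linked_diff_lnprod d1 d2 [:: c; m; m']); split; first exact: dist_neq d12.
have [_ {}cd1] := (linked_diff_lnprod c d1 [::]).1 cd1.
have [_ {}cd2] := (linked_diff_lnprod c d2 [:: m; m']).1 cd2.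
apply: (@linked_trans _ _ c); first (rewrite linked_sym; move: cd1).
  by apply: linked_sub; rewrite /= !inE !eqxx ?orbT.
by move: cd2; apply: linked_sub; rewrite /= !inE !eqxx ?orbT.
Qed.

Local Notation S := (R2 k `|` R3 k `|` R4 k `|` R5 k `|` R5' k).

Lemma S_linked f : S f -> linked_diff f.
Proof.
by move=> [[[[/R2_linked|/R3_linked]|/R4_linked]|/R5_linked]|/R5'_linked].
Qed.

(** Telescoping along a path from [p] to [q] leaves differences over edges, each of which is, up to
    sign, a relation multiplied by letters. *)
Lemma linked_ideal (I : lieIdeal L) s p q :
  cube_relations k `<=` I -> linked s p q -> I (ldiff s p q).
Proof.
move=> relI; have edgeI x y : x \in s -> y \in s -> dist x y = 1%N -> I (ldiff s x y).
  move=> xs ys xy; wlog yx : x y xs ys xy / (y < x)%O.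
    move=> WL; have := dist_neq xy; rewrite neq_lt => /orP[] lt_xy; last exact: WL.
    by rewrite (ldiffC ys xs); apply/idealN/WL; rewrite // distC.
  have xyI : I (x_ x ** x_ y) by apply: relI; exists x, y.
  rewrite /ldiff; elim: (rem _ _) (x_ x ** x_ y) xyI => //= a u IHu f fI.
  by apply/IHu/idealMl.
case/and3P=> ps _ /connectP[t pt ->] {q}.
elim: t p ps pt => [|x t IHt] p ps /=; first by rewrite ldiffxx => _; apply: ideal0.
case/andP=> /and3P[_ xs /eqP px] xt.
have ts : last x t \in s.
  by elim: t x xs xt {IHt px} => //= y t IHt x _ /andP[/and3P[_ ys _]]; apply: IHt.
by rewrite -(ldiff_add ps xs ts); apply: idealD; [apply: edgeI | apply: IHt].
Qed.

End CubeElements.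

(** * Reduction of linked differences by normal words *)

Section CubeBasis.
Variable k : fieldType.
Local Open Scope ring_scope.
Local Notation L := (free_metab k V3).
Local Notation ldiff := (@ldiff k _ V3).
Local Notation lfloor := (@lfloor k).
Local Notation x_ := (@gen k V3).
Local Notation S := (R2 k `|` R3 k `|` R4 k `|` R5 k `|` R5' k).
Implicit Types (f g h : L) (s t u : seq V3) (p q r e d : V3).

Lemma ldiff_lnprod_lfloor p q u : (q < p)%O ->
  ldiff [:: p, q & u] p q = lnprod (lfloor p q) u.
Proof.
by move=> qp; rewrite lnprod_lfloor ?(max_l (ltW qp)) ?(min_r (ltW qp)) // gt_eqF.
Qed.

Lemma R2_lfloor p q : dist p q = 1%N -> R2 k (lfloor p q).
Proof. by exists p, q. Qed.

Lemma R3_lfloor p m q :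
  dist p m = 1%N -> dist m q = 1%N -> dist p q = 2 -> R3 k (lfloor p q ** x_ m).
Proof.
by move=> pm mq pq; exists p, q, m; split=> //; apply: R2_lfloor; rewrite // distC.
Qed.

Lemma lfloorC p q : lfloor p q = lfloor q p.
Proof. by rewrite /Defs.lfloor maxC minC. Qed.

(** Induction on the length of a path from [p] to a smaller vertex. Either the path can be shortened
    with the same endpoint, or it has one to four edges and its vertices are the letters of an
    element of [R2], [R3], [R4] or [R5]. Distinctness of these letters makes [s0] a submultiset of
    [s]. *)
Lemma S_shortest_path s p q : linked s p q -> (q < p)%O ->
  exists s0 q1, [/\ {subset s0 <= s}, uniq s0, linked s0 p q1, (q1 < p)%O & S (ldiff s0 p q1)].
Proof.
case/and3P=> ps _ /connectP[t pt qE]; rewrite {}qE => {q}.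
have [n] := ubnP (size t); elim: n => // n IHn in t pt * => /ltnSE le_tn qp.
case: t pt qp le_tn => [|x1 t] /=; first by rewrite ltxx.
rewrite {1}/cube_edge /= => /andP[/and3P[_ x1s /eqP px1]] pt qp le_tn.
have uniq_dist n' x y : dist x y = n'.+1 -> (x == y) = false.
  by move=> /dist_neq/negPf.
case: t pt qp le_tn => [_ x1p _|x2 t] /=.
  exists [:: p; x1], x1; split=> //.
  - by apply/allP; rewrite /= ps x1s.
  - by rewrite /= inE (uniq_dist _ _ _ px1).
  - by apply: linked_edge; rewrite ?inE ?eqxx ?orbT.
  by rewrite ldiff_lnprod_lfloor //; do 4!left; apply: R2_lfloor.
rewrite {1}/cube_edge /= => /andP[/and3P[_ x2s /eqP x1x2]] pt qp le_tn.
(* If the path returns to [p] after two edges, those edges are cut off. *)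
have [/dist0_eq px2|px2] := dist_step2 px1 x1x2.
  rewrite -px2 in pt qp; apply: IHn pt _ qp; exact: ltnW.
case: t pt qp le_tn => [_ x2p _|x3 t] /=.
  exists [:: p; x2; x1], x2; split=> //.
  - by apply/allP; rewrite /= ps x1s x2s.
  - by rewrite /= !inE (uniq_dist _ _ _ px2) (uniq_dist _ _ _ px1) eq_sym (uniq_dist _ _ _ x1x2).
  - by apply: (@linked_trans _ _ x1); apply: linked_edge; rewrite ?inE ?eqxx ?orbT.
  by rewrite ldiff_lnprod_lfloor //; do 3!left; right; apply: R3_lfloor.
rewrite {1}/cube_edge /= => /andP[/and3P[_ x3s /eqP x2x3]] pt qp le_tn.
have shortcut x y u : path (cube_edge s) y u -> x \in s -> y \in s ->
    dist x y = 1%N -> path (cube_edge s) x (y :: u).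
  by move=> yu xs ys xy /=; rewrite yu /cube_edge /= xs ys xy.
(* Either [p] and [x3] are adjacent, which gives a shortcut, or they are antipodal. *)
have [px3|px3] := dist_step3 px2 x2x3.
  apply: (IHn (x3 :: t)) => //; [exact: shortcut | exact: ltnW].
have [/dist0_eq x13|x13] := dist_step2 x1x2 x2x3.
  by move: px3; rewrite -x13 px1.
case: t pt qp le_tn => [_ x3p _|x4 t] /=.
  exists [:: p; x3; x1; x2], x3; split=> //.
  - by apply/allP; rewrite /= ps x1s x2s x3s.
  - rewrite /= !inE (uniq_dist _ _ _ px3) (uniq_dist _ _ _ px2) (uniq_dist _ _ _ px1).
    by rewrite ![x3 == _]eq_sym (uniq_dist _ _ _ x13) (uniq_dist _ _ _ x2x3) (uniq_dist _ _ _ x1x2).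
  - apply: (@linked_trans _ _ x1); first by apply: linked_edge; rewrite ?inE ?eqxx ?orbT.
    by apply: (@linked_trans _ _ x2); apply: linked_edge; rewrite ?inE ?eqxx ?orbT.
  rewrite ldiff_lnprod_lfloor //; do 2!left; right; exists p, x3, x1, x2; split=> //.
    by apply: R2_lfloor; rewrite distC.
  exact: R3_lfloor.
rewrite {1}/cube_edge /= => /andP[/and3P[_ x4s /eqP x3x4]] pt qp le_tn.
have px4 : dist p x4 = 2 by rewrite (dist_antipode px3 x3x4).
have [/dist0_eq x24|x24] := dist_step2 x2x3 x3x4.
  rewrite -x24 in pt qp; apply: (IHn [:: x1, x2 & t]) => //; last exact: ltnW.
  by apply: (shortcut) => //; apply: shortcut.
case: t pt qp le_tn => [_ x4p _|x5 t] /=.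
  exists [:: p; x4; x2; x1; x3], x4; split=> //.
  - by apply/allP; rewrite /= ps x1s x2s x3s x4s.
  - have x14 : (x1 == x4) = false.
      by have [/uniq_dist|/uniq_dist] := dist_step3 x13 x3x4.
    rewrite /= !inE (uniq_dist _ _ _ px4) (uniq_dist _ _ _ px3).
    rewrite (uniq_dist _ _ _ px2) (uniq_dist _ _ _ px1).
    rewrite ![x4 == _]eq_sym (uniq_dist _ _ _ x24) x14 (uniq_dist _ _ _ x3x4).
    by rewrite [x2 == x1]eq_sym (uniq_dist _ _ _ x1x2) (uniq_dist _ _ _ x2x3) (uniq_dist _ _ _ x13).
  - apply: (@linked_trans _ _ x1); first by apply: linked_edge; rewrite ?inE ?eqxx ?orbT.
    apply: (@linked_trans _ _ x2); first by apply: linked_edge; rewrite ?inE ?eqxx ?orbT.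
    by apply: (@linked_trans _ _ x3); apply: linked_edge; rewrite ?inE ?eqxx ?orbT.
  (* Elements of [R5] list their last two letters in non-decreasing order. *)
  rewrite (@ldiff_perm _ _ _ _ [:: p, x4, x2 & angle [:: x1; x3]]); last first.
    by rewrite !perm_cons perm_sym perm_sort.
  rewrite ldiff_lnprod_lfloor //; left; right.
  exists p, x4, x2, x1, x3; split=> //; last exact: R3_lfloor.
  by rewrite lfloorC; apply: R3_lfloor.
rewrite {1}/cube_edge /= => /andP[/and3P[_ x5s /eqP x4x5]] pt qp le_tn.
(* Five edges always admit a shortcut: [x5] is adjacent to [x2], or it is the antipode of [x2] and
   then adjacent to [p], since [p] is at distance 2 from [x2]. *)
have [x25|x25] := dist_step3 x24 x4x5.
  apply: (IHn [:: x1, x2, x5 & t]) => //; last exact: ltnW.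
  by apply: (shortcut) => //; apply: (shortcut) => //; apply: shortcut.
have px5 : dist p x5 = 1%N by rewrite distC (@dist_antipode _ x2 _ 2) // distC.
apply: (IHn (x5 :: t)) => //; last by do 3!apply: ltnW.
exact: shortcut.
Qed.

Lemma uniq_perm_cat s0 s : uniq s0 -> {subset s0 <= s} -> exists u, perm_eq s (s0 ++ u).
Proof.
elim: s0 s => [|x s0 IHs] s /=; first by exists s.
case/andP=> xs0 us0 sub; have xs := sub _ (mem_head x s0).
have [|u su] := IHs (rem x s) us0.
  move=> y ys0; have := sub y; rewrite inE ys0 orbT => /(_ isT).
  rewrite (perm_mem (perm_to_rem xs)) inE => /orP[/eqP yx|//].
  by rewrite -yx ys0 in xs0.
by exists u; rewrite (permPl (perm_to_rem xs)) perm_cons.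
Qed.

(** The element found along the path is multiplied by the remaining letters of [s] in non-decreasing
    order, which is a normal word of the first kind. *)
Lemma linked_normal_word s p q : linked s p q -> (q < p)%O ->
  exists q1, [/\ linked s p q1, (q1 < p)%O & normal_word S (ldiff s p q1)].
Proof.
move=> spq /(S_shortest_path spq)[s0 [q1 [sub us0 s0pq1 q1p Sf]]].
have [u su] := uniq_perm_cat us0 sub; exists q1; split=> //.
  by apply: linked_sub s0pq1; apply/allP.
have [ps qs] := (linked_meml s0pq1, linked_memr s0pq1).
have -> : ldiff s p q1 = lnprod (ldiff s0 p q1) (sort <=%O u).
  rewrite ldiff_cat //; apply: ldiff_perm; apply: perm_trans su _.
  by rewrite perm_cat2l perm_sym perm_sort.
apply: NormalLetters => //.
(* The leading word has at least two letters, so it is not the single letter [a]. *)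
move=> a u' _; exists (rword s0 p); first exact: is_lead_ldiff.
move=> E; have := size_rword ps; rewrite E (perm_size (perm_to_rem2 _ ps qs)) //.
by rewrite gt_eqF.
Qed.

(** The larger letter [p] is lowered repeatedly: subtracting the normal word [ldiff s p q1] with
    [q1 < p] leaves [ldiff s q1 q], again linked. All leading words used begin with a letter below
    [a], hence lie below [rword s a]. *)
Lemma linked_trivial_mod s a p q : a \in s -> linked s p q -> (p < a)%O -> (q < a)%O ->
  trivial_mod S (rword s a) (ldiff s p q).
Proof.
move=> sa; rewrite /trivial_mod; set T := [set _ | _].
have spanN f : Defs.span T f -> Defs.span T (- f).
  by move=> Tf; rewrite -scaleN1r -[_ *: _]addr0; apply: spanPZ (span0 T).
have spanD f g : Defs.span T f -> Defs.span T g -> Defs.span T (f + g).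
  by move=> Tf; rewrite -[f]scale1r; apply: spanPZ.
have sub_below x y : (x < y)%O -> (#|[pred z : V3 | (z < x)%O]| < #|[pred z : V3 | (z < y)%O]|)%N.
  move=> xy; apply/proper_card/properP; split.
    by apply/fintype.subsetP => z; rewrite !inE => /lt_trans; apply.
  by exists x; rewrite !inE ?xy // ltxx.
(* The induction measure is the number of vertices below the larger letter. *)
have descend n p' q' : (#|[pred z : V3 | (z < p')%O]| < n)%N -> linked s p' q' ->
    (p' < a)%O -> (q' < p')%O -> Defs.span T (ldiff s p' q').
  elim: n => // n IHn in p' q' *; move=> /ltnSE le_n link pa qp.
  have [q1 [link1 q1p nw]] := linked_normal_word link qp.
  have [ps qs q1s] := And3 (linked_meml link) (linked_memr link) (linked_memr link1).
  have Tq1 : Defs.span T (ldiff s p' q1).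
    apply: span_sub; split=> //; exists (rword s p'); first exact: is_lead_ldiff.
    exact: rword_wlt.
  have link' : linked s q1 q' by apply: linked_trans link; rewrite linked_sym.
  rewrite -(ldiff_add ps q1s qs); apply: (spanD _ _ Tq1).
  case: (ltgtP q1 q') => [lt_q1q|lt_qq1|->]; last by rewrite ldiffxx; apply: span0.
    rewrite (ldiffC qs q1s); apply/spanN/IHn => //; last exact: lt_trans pa.
      exact: leq_trans (sub_below _ _ qp) _.
    by rewrite linked_sym.
  apply: IHn => //; last exact: lt_trans pa.
  exact: leq_trans (sub_below _ _ q1p) _.
move=> link pa qa; have [ps qs] := (linked_meml link, linked_memr link).
case: (ltgtP p q) => [lt_pq|lt_qp|->]; last by rewrite ldiffxx; apply: span0.
  by rewrite (ldiffC qs ps); apply/spanN/(descend _ _ _ (leqnn _)); rewrite // linked_sym.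
exact: descend (leqnn _) _ _ _.
Qed.

End CubeBasis.

(** * Equality of the two ideals and triviality of all compositions *)

Theorem theorem3p10 (k : fieldType) :
  GS_basis_for (cube_relations k) (R2 k `|` R3 k `|` R4 k `|` R5 k `|` R5' k).
Proof.
split; last first.
  (* Each ideal contains the generators of the other: the relations belong to [R2], and elements of
     the five sets are linked differences. *)
  rewrite predeqE => f; split=> Sf I idI subI; last first.
    apply: Sf => // h [e [d [ed de ->]]]; apply: subI; do 4!left.
    by exists e, d; rewrite /lfloor (max_l (ltW de)) (min_r (ltW de)).
  apply: Sf => // h /S_linked[s [p [q [link _ ->]]]].
  exact: (@linked_ideal _ (LieIdeal idI)).
split=> [f /S_linked[s [p [q [link qp ->]]]]|].
  have [ps qs] := (linked_meml link, linked_memr link).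
  by exists (rword s p); [apply: is_lead_ldiff | apply: coefN_ldiff_lead].
move=> f g w h /S_linked[s [p [q [link qp ->]]]] /S_linked[s' [p' [q' [link' qp' ->]]]].
have [ps qs] := (linked_meml link, linked_memr link).
have [ps' qs'] := (linked_meml link', linked_memr link').
case/(composition_ldiff ps qs qp ps' qs' qp') => t [pp' st s't -> ->].
rewrite {}pp' in link' qp' *.
apply: linked_trivial_mod => //; first exact: st.
(* Both [q'] and [q] are linked to [p] within the larger multiset [t]. *)
apply: (@linked_trans _ _ p); last by apply: linked_sub link; apply/allP.
by rewrite linked_sym; apply: linked_sub link'; apply/allP.
Qed.
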